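(* Let $q$ be a nonzero complex number which is not a root of unity and $n\ge 1$. Every finite-dimensional irreducible representation $V$ of the twisted $q$-Yangian $\mathrm{Y}'_q(\mathfrak{sp}_{2n})$ is a highest weight representation. Moreover, $V$ contains a unique, up to a constant factor, highest vector.
   Context: $R(u,v)=(u-v)\sum_{i\ne j}E_{ii}\otimes E_{jj}+(q^{-1}u-qv)\sum_i E_{ii}\otimes E_{ii}+(q^{-1}-q)u\sum_{i>j}E_{ij}\otimes E_{ji}+(q^{-1}-q)v\sum_{i<j}E_{ij}\otimes E_{ji}$, indices in $\{1,\dots,2n\}$, $E_{ij}$ matrix units. $\mathrm{U}^{\rm ext}_q(\widehat{\mathfrak{gl}}_{2n})$ is the algebra with generators $t_{ij}^{(r)},\bar t_{ij}^{(r)}$ ($r\ge0$) and $(t_{ii}^{(0)})^{-1},(\bar t_{ii}^{(0)})^{-1}$, with $t_{ij}(u)=\sum_r t_{ij}^{(r)}u^{-r}$, $\bar t_{ij}(u)=\sum_r\bar t_{ij}^{(r)}u^r$, $T(u)=\sum t_{ij}(u)\otimes E_{ij}$, $\overline T(u)=\sum\bar t_{ij}(u)\otimes E_{ij}$, and relations $t_{ij}^{(0)}=\bar t_{ji}^{(0)}=0$ for $i<j$, $t_{ii}^{(0)}\bar t_{ii}^{(0)}=\bar t_{ii}^{(0)}t_{ii}^{(0)}$, the inverses being two-sided inverses, $R(u,v)T_1(u)T_2(v)=T_2(v)T_1(u)R(u,v)$, $R(u,v)\overline T_1(u)\overline T_2(v)=\overline T_2(v)\overline T_1(u)R(u,v)$,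 $R(u,v)\overline T_1(u)T_2(v)=T_2(v)\overline T_1(u)R(u,v)$. Put $s_{ij}(u)=q\sum_{a=1}^n t_{i,2a-1}(u)\bar t_{j,2a}(u^{-1})-\sum_{a=1}^n t_{i,2a}(u)\bar t_{j,2a-1}(u^{-1})=\sum_{r\ge0}s_{ij}^{(r)}u^{-r}$ and $\bar s_{ij}(u)=q\sum_a\bar t_{i,2a-1}(u)t_{j,2a}(u^{-1})-\sum_a\bar t_{i,2a}(u)t_{j,2a-1}(u^{-1})$. $\mathrm{Y}'_q(\mathfrak{sp}_{2n})$ is the subalgebra generated by all $s_{ij}^{(r)}$ and the inverses of $s_{i,i+1}^{(0)}=q\,t^{(0)}_{ii}\bar t^{(0)}_{i+1,i+1}$ for odd $i$; the coefficients of $\bar s_{ij}(u)$ lie in it. Let $\varsigma(i)=i$ for $i$ odd and $\varsigma(i)=-i+1$ for $i$ even. A representation $V$ is a highest weight representation if it is generated by a nonzero vector $\xi$ (a highest vector) such that $s_{kl}(u)\xi=0$ whenever $\varsigma(k)+\varsigma(l)>0$, and $s_{2i,2i-1}(u)\xi=\mu_i(u)\xi$, $\bar s_{2i,2i-1}(u)\xi=\bar\mu_i(u)\xi$ for $i=1,\dots,n$, for some formal series $\mu_i(u)\in\mathbb{C}[[u^{-1}]]$, $\bar\mu_i(u)\in\mathbb{C}[[u]]$. *)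

(* Defs.v *)
(* Twisted q-Yangian Y'_q(sp_2n) as the subalgebra of
   U^ext_q(gl_2n hat) generated by the s_ij^(r) and the inverses of the
   s_{i,i+1}^(0), i odd. *)
From HB Require Import structures.
From mathcomp Require Import all_boot all_order all_algebra.
From mathcomp Require Import complex.
From mathcomp Require Import Rstruct.
Set Implicit Arguments. Unset Strict Implicit. Unset Printing Implicit Defensive.
Import Order.TTheory GRing.Theory Num.Theory.
Local Open Scope ring_scope.

Definition CC : fieldType := (Rdefinitions.R)[i]%C.

(* Indices 1..2n of the paper are encoded by k : 'I_(2*n), paper index = k.+1. *)
Notation idx n := ('I_(2 * n)).

Section Defs.
Variable n : nat.
Variable q : CC.

(* Entries of R(u,v) = alpha * u + beta * v, in position
   (E_ac (x) E_bd), i.e. ((a,b),(c,d)). *)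
Definition Ralpha (a b c d : idx n) : CC :=
  if (a == c) && (b == d) then (if a == b then q^-1 else 1)
  else if (a == d) && (b == c) && (a != b) then
         (if (b < a)%N then q^-1 - q else 0)
  else 0.
Definition Rbeta (a b c d : idx n) : CC :=
  if (a == c) && (b == d) then (if a == b then - q else -1)
  else if (a == d) && (b == c) && (a != b) then
         (if (a < b)%N then q^-1 - q else 0)
  else 0.

(* The relation R(u,v) X_1(u) Y_2(v) = Y_2(v) X_1(u) R(u,v), written
   coefficientwise: X i j m is the coefficient of u^m in x_ij(u),
   Y k l p the coefficient of v^p in y_kl(v) (m, p integers). *)
Definition RTT_rel (A : algType CC) (X Y : idx n -> idx n -> int -> A) : Prop :=
  forall (a b c d : idx n) (m p : int),
    \sum_(i : idx n) \sum_(k : idx n)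
       (Ralpha a b i k *: (X i c (m - 1) * Y k d p)
        + Rbeta a b i k *: (X i c m * Y k d (p - 1)))
  = \sum_(i : idx n) \sum_(k : idx n)
       (Ralpha i k c d *: (Y b k p * X a i (m - 1))
        + Rbeta i k c d *: (Y b k (p - 1) * X a i m)).

(* coefficient of u^m in t_ij(u) = sum_r t_ij^(r) u^-r *)
Definition Tser (A : Type) (z : A) (t : idx n -> idx n -> nat -> A) i j (m : int) : A :=
  match m with
  | Posz 0 => t i j 0%N
  | Posz _ => z
  | Negz k => t i j k.+1
  end.
(* coefficient of u^m in tbar_ij(u) = sum_r tbar_ij^(r) u^r *)
Definition TBser (A : Type) (z : A) (t : idx n -> idx n -> nat -> A) i j (m : int) : A :=
  match m with
  | Posz k => t i j k
  | Negz _ => z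
  end.

(* A family of elements of a CC-algebra A satisfying the defining relations
   of U^ext_q(gl_2n hat); t^(r)_ij, tbar^(r)_ij, (t_ii^(0))^-1, (tbar_ii^(0))^-1. *)
Record Uext_model (A : algType CC) := UextModel {
  tt : idx n -> idx n -> nat -> A;
  tb : idx n -> idx n -> nat -> A;
  tinv : idx n -> A;
  tbinv : idx n -> A }.

Definition is_Uext_model (A : algType CC) (M : Uext_model A) : Prop :=
  [/\ forall i j : idx n, (i < j)%N -> tt M i j 0%N = 0 /\ tb M j i 0%N = 0,
      forall i : idx n, tt M i i 0%N * tb M i i 0%N = tb M i i 0%N * tt M i i 0%N,
      forall i : idx n, tinv M i * tt M i i 0%N = 1 /\ tt M i i 0%N * tinv M i = 1,
      forall i : idx n, tbinv M i * tb M i i 0%N = 1 /\ tb M i i 0%N * tbinv M i = 1 &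
      [/\ RTT_rel (Tser 0 (tt M)) (Tser 0 (tt M)),
          RTT_rel (TBser 0 (tb M)) (TBser 0 (tb M)) &
          RTT_rel (TBser 0 (tb M)) (Tser 0 (tt M))]].

(* the form appearing in s_ij(u): coefficient of t_{iJ} tbar_{jK}
   (paper indices J = j.+1, K = k.+1):  q if J odd and K = J+1,
   -1 if J even and K = J-1, 0 otherwise. *)
Definition omega (j k : idx n) : CC :=
  if odd j.+1 && (k.+1 == j.+2) then q
  else if ~~ odd j.+1 && (k.+2 == j.+1) then -1
  else 0.

Definition s_coef (A : algType CC) (M : Uext_model A) (i j : idx n) (r : nat) : A :=
  \sum_(l < r.+1) \sum_(J : idx n) \sum_(K : idx n)
     omega J K *: (tt M i J l * tb M j K (r - l)%N).
Definition sbar_coef (A : algType CC) (M : Uext_model A) (i j : idx n) (r : nat) : A :=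
  \sum_(l < r.+1) \sum_(J : idx n) \sum_(K : idx n)
     omega J K *: (tb M i J l * tt M j K (r - l)%N).

(* the element i_of a : 'I_n  is the odd paper index 2a+1 (0-based 2a);
   its successor (paper 2a+2) is 0-based 2a+1. *)
Lemma odd_idx_lt (a : 'I_n) : (a.*2 < 2 * n)%N.
Proof. by rewrite mul2n ltn_double ltn_ord. Qed.
Lemma even_idx_lt (a : 'I_n) : (a.*2.+1 < 2 * n)%N.
Proof. by rewrite mul2n ltn_Sdouble ltn_ord. Qed.
Definition oidx (a : 'I_n) : idx n := Ordinal (odd_idx_lt a).
Definition eidx (a : 'I_n) : idx n := Ordinal (even_idx_lt a).

(* inverse of s_{i,i+1}^(0) = q t_ii^(0) tbar_{i+1,i+1}^(0)  (i = 2a+1 odd) *)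
Definition sinv (A : algType CC) (M : Uext_model A) (a : 'I_n) : A :=
  q^-1 *: (tbinv M (eidx a) * tinv M (oidx a)).

Inductive yterm : Type :=
| YS of idx n & idx n & nat
| YI of 'I_n                      (* (s_{2a+1,2a+2}^(0))^-1, paper indices *)
| YC of CC
| YAdd of yterm & yterm
| YMul of yterm & yterm.

Fixpoint yeval (A : algType CC) (gS : idx n -> idx n -> nat -> A)
    (gI : 'I_n -> A) (p : yterm) : A :=
  match p with
  | YS i j r => gS i j r
  | YI a => gI a
  | YC c => c%:A
  | YAdd x y => yeval gS gI x + yeval gS gI y
  | YMul x y => yeval gS gI x * yeval gS gI y
  end.

Definition yval (A : algType CC) (M : Uext_model A) (p : yterm) : A :=
  yeval (s_coef M) (sinv M) p.

(* p = 0 in Y'_q(sp_2n) (subset of U^ext): p vanishes in every model *)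
Definition yzero (p : yterm) : Prop :=
  forall (A : algType CC) (M : Uext_model A), is_Uext_model M -> yval M p = 0.

Definition represents_sbar (p : yterm) (i j : idx n) (r : nat) : Prop :=
  forall (A : algType CC) (M : Uext_model A), is_Uext_model M ->
    yval M p = sbar_coef M i j r.

(* A representation of Y'_q(sp_2n) on V = CC^(d+1) (column vectors):
   images of the generators, such that the induced map is a well-defined
   algebra homomorphism Y' -> End(V). *)
Definition is_rep (d : nat) (rS : idx n -> idx n -> nat -> 'M[CC]_d.+1)
    (rI : 'I_n -> 'M[CC]_d.+1) : Prop :=
  forall p, yzero p -> yeval rS rI p = 0.

(* irreducibility: no invariant subspaces except 0 and V. A subspace W is
   given as the row space of U (rows = transposes of vectors of W). *)
Definition rep_irreducible (d : nat) (rS : idx n -> idx n -> nat -> 'M[CC]_d.+1)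
    (rI : 'I_n -> 'M[CC]_d.+1) : Prop :=
  forall U : 'M[CC]_d.+1,
    (forall p, (U *m (yeval rS rI p)^T <= U)%MS) ->
    (U == (0 : 'M[CC]_d.+1))%MS \/ row_full U.

(* varsigma(k) for paper index k *)
Definition vsig (k : nat) : int := if odd k then k%:Z else 1 - k%:Z.

Definition highest_vector (d : nat) (rS : idx n -> idx n -> nat -> 'M[CC]_d.+1)
    (rI : 'I_n -> 'M[CC]_d.+1) (xi : 'cV[CC]_d.+1) : Prop :=
  [/\ xi != 0,
      forall v : 'cV[CC]_d.+1, exists p, v = yeval rS rI p *m xi,
      forall (k l : idx n) (r : nat), (0 < vsig k.+1 + vsig l.+1)%R ->
        rS k l r *m xi = 0,
      (* s_{2i,2i-1}(u) xi = mu_i(u) xi *)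
      forall (k l : idx n) (r : nat), ~~ odd k.+1 -> k.+1 = l.+2 ->
        exists c : CC, rS k l r *m xi = c *: xi &
      (* sbar_{2i,2i-1}(u) xi = mubar_i(u) xi *)
      forall (k l : idx n) (r : nat), ~~ odd k.+1 -> k.+1 = l.+2 ->
        forall p, represents_sbar p k l r ->
        exists c : CC, yeval rS rI p *m xi = c *: xi].

End Defs.

(* Main.v *)
(* Writing S(u) = T(u) G Tbar(u^-1)^t, the RTT relations give the reflection
   equation R(u,v) S_1(u) R'(u^-1,v) S_2(v) = S_2(v) R'(u^-1,v) S_1(u) R(u,v),
   which is the only property of the s_ij(u) needed besides the weights of the
   s_{2a-1,2a}^(0).  Give s_kl height vsig(k) + vsig(l).
   - For any fixed index M, the reflection equation rewrites a product
     s_kl s_k'l' with M among k, l through products having M among k', l', and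
     conversely.  Choosing M extremal, a raising (positive height) letter can be
     moved to the right of a non-raising one, so a module generated by a vector
     xi killed by the raising letters is spanned by the words in non-raising
     letters applied to xi.
   - The operator H = prod_a (s_{2a-1,2a}^(0))^(2a-1) satisfies
     H s_kl = q^height(k,l) s_kl H.  As q is not a root of unity, H has an
     eigenvalue k such that no k q^h with h > 0 is one; its eigenspace is killed
     by the raising letters, and there the letters of height 0 commute by the
     reflection equation.  A common eigenvector xi generates V, so by the first
     point V is spanned by vectors of H-eigenvalues k q^h with h <= 0 and the
     k-eigenspace is the line of xi.  Applying the same to another highest
     vector shows that it has H-eigenvalue k, hence lies on this line. *)
Require Import Defs.
From HB Require Import structures.
From mathcomp Require Import all_boot all_order all_algebra.
From mathcomp Require Import complex Rstruct boolp.
From mathcomp Require Import ring zify.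
Set Implicit Arguments. Unset Strict Implicit. Unset Printing Implicit Defensive.
Import Order.TTheory GRing.Theory Num.Theory.
Local Open Scope ring_scope.

(** * Formal power series *)

Record ps (R : Type) := Ps { psc :> nat -> R }.

Lemma psP (R : Type) (f g : ps R) : (forall n, f n = g n) <-> f = g.
Proof.
split=> [|-> //]; case: f g => [f] [g] /= fg; congr Ps; exact/funext.
Qed.

HB.instance Definition _ (R : Type) := gen_eqMixin (ps R).
HB.instance Definition _ (R : Type) := gen_choiceMixin (ps R).

(** Reindexing by [m = i + j]. The associativity laws for Cauchy products below reduce to it. *)
Lemma triangular_exchange (V : nmodType) n (F : nat -> nat -> V) :
  \sum_(i < n.+1) \sum_(j < (n - i).+1) F i j
  = \sum_(m < n.+1) \sum_(i < m.+1) F i (m - i)%N.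
Proof.
rewrite -(big_mkord xpredT (fun i => \sum_(j < (n - i).+1) F i j)).
rewrite -(big_mkord xpredT (fun m => \sum_(i < m.+1) F i (m - i)%N)).
transitivity (\sum_(0 <= i < n.+1) \sum_(0 <= m < n.+1 | (i <= m)%N) F i (m - i)%N).
  rewrite big_nat [RHS]big_nat; apply: eq_bigr => i /andP[_ ltin].
  rewrite -(big_mkord xpredT (F i)) -(subSn (ltin : (i <= n)%N)).
  under [RHS]eq_bigl do rewrite -[(i <= _)%N]/(true && _).
  rewrite -(big_nat_widenl i 0 n.+1 xpredT (fun m => F i (m - i)%N)) //.
  transitivity (\sum_(0 + i <= m < n.+1) F i (m - i)%N); last by rewrite add0n.
  by rewrite big_addn; apply: eq_bigr => m _; rewrite addnK.
rewrite (exchange_big_dep_nat xpredT) //=; rewrite big_nat [RHS]big_nat.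
apply: eq_bigr => m /andP[_ ltmn].
rewrite -(big_mkord xpredT (fun i => F i (m - i)%N)).
by rewrite (big_nat_widen 0 _ _ _ _ ltmn).
Qed.

(* The operations are locked: otherwise unification unfolds series into their
   coefficients, and then into real numbers. *)
HB.lock Definition psopp (V : zmodType) (f : ps V) : ps V := Ps (fun n => - f n).
HB.lock Definition psadd (V : zmodType) (f g : ps V) : ps V := Ps (fun n => f n + g n).
HB.lock Definition psmul (R : nzRingType) (f g : ps R) : ps R :=
  Ps (fun n => \sum_(i < n.+1) f i * g (n - i)%N).
HB.lock Definition psscale (K : nzRingType) (V : lmodType K) (a : ps K) (f : ps V) : ps V :=
  Ps (fun n => \sum_(i < n.+1) a i *: f (n - i)%N).

Section PsZmod.
Variable V : zmodType.
Implicit Types f g : ps V.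

Definition ps0 : ps V := Ps (fun=> 0).
Let addE f g n : psadd f g n = f n + g n. Proof. by rewrite unlock. Qed.
Let oppE f n : psopp f n = - f n. Proof. by rewrite unlock. Qed.
Let addA : associative (@psadd V).
Proof. by move=> f g h; apply/psP => n; rewrite !addE addrA. Qed.
Let addC : commutative (@psadd V).
Proof. by move=> f g; apply/psP => n; rewrite !addE addrC. Qed.
Let add0 : left_id ps0 (@psadd V).
Proof. by move=> f; apply/psP => n; rewrite addE add0r. Qed.
Let addN : left_inverse ps0 (@psopp V) (@psadd V).
Proof. by move=> f; apply/psP => n; rewrite addE oppE addNr. Qed.
HB.instance Definition _ := GRing.isZmodule.Build (ps V) addA addC add0 addN.

Lemma ps0E n : (0 : ps V) n = 0. Proof. by []. Qed.
Lemma psDE f g n : (f + g) n = f n + g n. Proof. exact: addE. Qed.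
Lemma psNE f n : (- f) n = - f n. Proof. exact: oppE. Qed.
Lemma psBE f g n : (f - g) n = f n - g n. Proof. by rewrite psDE psNE. Qed.
Lemma ps_sumE I (r : seq I) (P : pred I) (F : I -> ps V) n :
  (\sum_(i <- r | P i) F i) n = \sum_(i <- r | P i) F i n.
Proof. by elim/big_rec2: _ => // i a b _ <-; rewrite psDE. Qed.

Definition psC (v : V) : ps V := Ps (fun n => if n is 0 then v else 0).
End PsZmod.

Section PsRing.
Variable R : nzRingType.
Implicit Types f g h : ps R.

Definition ps1 : ps R := psC 1.
Let mulE f g n : psmul f g n = \sum_(i < n.+1) f i * g (n - i)%N.
Proof. by rewrite unlock. Qed.
Let mulA : associative (@psmul R).
Proof.
move=> f g h; apply/psP => n; rewrite !mulE.
under eq_bigr do rewrite mulE big_distrr /=.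
under [RHS]eq_bigr do rewrite mulE big_distrl /=.
rewrite (triangular_exchange n (fun i j => f i * (g j * h (n - i - j)%N))).
apply: eq_bigr => i _; apply: eq_bigr => j _; rewrite mulrA -subnDA subnKC //.
by rewrite -ltnS.
Qed.
Let mul1 : left_id ps1 (@psmul R).
Proof.
move=> f; apply/psP => n; rewrite mulE big_ord_recl /= mul1r subn0 big1 ?addr0 //.
by move=> i _; rewrite mul0r.
Qed.
Let mulr1 : right_id ps1 (@psmul R).
Proof.
move=> f; apply/psP => n; rewrite mulE big_ord_recr /= subnn mulr1 big1 ?add0r //.
by move=> [i lti] _ /=; rewrite -(subnSK lti) mulr0.
Qed.
Let mulDl : left_distributive (@psmul R) +%R.
Proof.
move=> f g h; apply/psP => n; rewrite psDE !mulE -big_split.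
by apply: eq_bigr => i _; rewrite psDE mulrDl.
Qed.
Let mulDr : right_distributive (@psmul R) +%R.
Proof.
move=> f g h; apply/psP => n; rewrite psDE !mulE -big_split.
by apply: eq_bigr => i _; rewrite psDE mulrDr.
Qed.
Let one_neq0 : ps1 != 0.
Proof. by apply/eqP => /psP/(_ 0%N)/eqP; rewrite /= oner_eq0. Qed.
HB.instance Definition _ :=
  GRing.Zmodule_isNzRing.Build (ps R) mulA mul1 mulr1 mulDl mulDr one_neq0.

Lemma psME f g n : (f * g) n = \sum_(i < n.+1) f i * g (n - i)%N.
Proof. exact: mulE. Qed.
Definition psX : ps R := Ps (fun n => (n == 1%N)%:R).
End PsRing.
Arguments psX {R}.

Section PsComRing.
Variable R : comNzRingType.
Let mulC : commutative (@GRing.mul (ps R)).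
Proof.
move=> f g; apply/psP => n; rewrite !psME (reindex_inj rev_ord_inj) /=.
apply: eq_bigr => [[i lti]] _ /=.
by rewrite subSS subKn // mulrC.
Qed.
HB.instance Definition _ := GRing.PzRing_hasCommutativeMul.Build (ps R) mulC.
End PsComRing.

Section PsLmod.
Variables (K : nzRingType) (V : lmodType K).
Let scaleE (a : ps K) (f : ps V) n : psscale a f n = \sum_(i < n.+1) a i *: f (n - i)%N.
Proof. by rewrite unlock. Qed.
Let scaleA (a b : ps K) (v : ps V) : psscale a (psscale b v) = psscale (a * b) v.
Proof.
apply/psP => n; rewrite !scaleE.
under eq_bigr do rewrite scaleE scaler_sumr /=.
under [RHS]eq_bigr do rewrite psME scaler_suml /=.
rewrite (triangular_exchange n (fun i j => a i *: (b j *: v (n - i - j)%N))).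
apply: eq_bigr => i _; apply: eq_bigr => j _; rewrite scalerA -subnDA subnKC //.
by rewrite -ltnS.
Qed.
Let scale1 : left_id 1 (@psscale K V).
Proof.
move=> f; apply/psP => n; rewrite scaleE big_ord_recl /= scale1r subn0 big1 ?addr0 //.
by move=> i _; rewrite scale0r.
Qed.
Let scaleDr : right_distributive (@psscale K V) +%R.
Proof.
move=> f g h; apply/psP => n; rewrite psDE !scaleE -big_split.
by apply: eq_bigr => i _; rewrite psDE scalerDr.
Qed.
Let scaleDl (v : ps V) : {morph (@psscale K V)^~ v : a b / a + b}.
Proof.
move=> f g; apply/psP => n; rewrite psDE !scaleE -big_split.
by apply: eq_bigr => i _; rewrite psDE scalerDl.
Qed.
HB.instance Definition _ :=
  GRing.Zmodule_isLmodule.Build (ps K) (ps V) scaleA scale1 scaleDr scaleDl.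

Lemma psZE (a : ps K) (f : ps V) n : (a *: f) n = \sum_(i < n.+1) a i *: f (n - i)%N.
Proof. exact: scaleE. Qed.
Lemma psCZE (a : K) (f : ps V) n : (psC a *: f) n = a *: f n.
Proof.
rewrite psZE big_ord_recl /= subn0 big1 ?addr0 //.
by move=> i _; rewrite scale0r.
Qed.
Lemma psXZE (f : ps V) n : (psX *: f) n = if n is m.+1 then f m else 0.
Proof.
rewrite psZE big_ord_recl /= scale0r add0r; case: n => [|n]; first by rewrite big_ord0.
rewrite big_ord_recl /= subSS subn0 scale1r big1 ?addr0 // => i _.
by rewrite /bump /= scale0r.
Qed.
End PsLmod.

Section PsAlg.
Variables (K : comNzRingType) (A : algType K).
Let scaleAl (a : ps K) (f g : ps A) : a *: (f * g) = (a *: f) * g.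
Proof.
apply/psP => n; rewrite psZE psME.
under eq_bigr do rewrite psME scaler_sumr /=.
under [RHS]eq_bigr do rewrite psZE mulr_suml /=.
rewrite (triangular_exchange n (fun i j => a i *: (f j * g (n - i - j)%N))).
apply: eq_bigr => i _; apply: eq_bigr => j _; rewrite scalerAl -subnDA subnKC //.
by rewrite -ltnS.
Qed.
HB.instance Definition _ := GRing.Lmodule_isLalgebra.Build (ps K) (ps A) scaleAl.
Let scaleAr (a : ps K) (f g : ps A) : a *: (f * g) = f * (a *: g).
Proof.
apply/psP => n; rewrite psZE psME.
under eq_bigr do rewrite psME scaler_sumr /=.
under [RHS]eq_bigr do rewrite psZE mulr_sumr /=.
rewrite (triangular_exchange n (fun i j => a i *: (f j * g (n - i - j)%N))).
rewrite (triangular_exchange n (fun i j => f i * (a j *: g (n - i - j)%N))).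
apply: eq_bigr => i _; rewrite [RHS](reindex_inj rev_ord_inj) /=.
apply: eq_bigr => [[j ltj]] _ /=; rewrite subSS scalerAr subKn //.
by rewrite -!subnDA subnKC // subnK.
Qed.
HB.instance Definition _ := GRing.Lalgebra_isAlgebra.Build (ps K) (ps A) scaleAr.
End PsAlg.

Definition torsion_free (K : nzRingType) (V : lmodType K) :=
  forall (a : K) (v : V), a != 0 -> a *: v = 0 -> v = 0.

Lemma ps_neq0 (V : zmodType) (f : ps V) :
  f != 0 -> exists2 n, f n != 0 & forall m, (m < n)%N -> f m = 0.
Proof.
move=> f0; have ex : exists n, f n != 0.
  apply: contrapT => nex; case/eqP: f0; apply/psP => n; rewrite ps0E.
  by apply/eqP; apply: contrapT => /negP fn; apply: nex; exists n.
exists (ex_minn ex); case: ex_minnP => // n _ min m ltmn.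
by apply/eqP; apply: contraLR ltmn => /min; rewrite -leqNgt.
Qed.

(** If [a] and [f] start in degrees [k] and [l], the coefficient of degree [k + l] in [a *: f] is
    the product of their leading coefficients. *)
Lemma ps_torsion_free (K : nzRingType) (V : lmodType K) :
  torsion_free V -> torsion_free (ps V).
Proof.
move=> tfV a f a0 af0; apply/eqP; apply: contrapT => /negP f0.
have [k ak mink] := ps_neq0 a0; have [l fl minl] := ps_neq0 f0.
case/eqP: fl; apply: (tfV _ _ ak); move/psP: af0 => /(_ (k + l)%N).
have ltk : (k < (k + l).+1)%N by rewrite ltnS leq_addr.
rewrite psZE (bigD1 (Ordinal ltk)) //= addKn big1 ?addr0 // => i ik.
case: (ltngtP i k) => ltik; first by rewrite mink ?scale0r.
  rewrite minl ?scaler0 // ltn_subLR ?ltn_add2r //.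
  by rewrite -ltnS.
by case/eqP: ik; apply: val_inj.
Qed.

(** * The reflection equation *)

Section Exchange.
Variables (n : nat) (K : comNzRingType) (q qi : K).
Implicit Types (a b c d i j J L M N : 'I_(2 * n)) (U V : K).

(** The entries of [R(U, V)] at the tensor products [E_aa, E_bb] and, for [a != b], [E_ab, E_ba];
    [qi] plays the role of [q^-1]. *)
Definition rdiag U V a b : K := if a == b then qi * U - q * V else U - V.
Definition roff U V a b : K :=
  (qi - q) * (if (b < a)%N then U else if (a < b)%N then V else 0).

(** [R(U, V) X_1 Y_2 = Y_2 X_1 R(U, V)] entry by entry; each row and column of [R] has at most two
    nonzero entries. *)
Definition exchange (P : algType K) U V (X Y : 'I_(2 * n) -> 'I_(2 * n) -> P) :=
  forall a b c d,
    rdiag U V a b *: (X a c * Y b d) + roff U V a b *: (X b c * Y a d)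
  = rdiag U V c d *: (Y b d * X a c) + roff U V d c *: (Y b c * X a d).

Lemma rdiag_sym U V a b : rdiag U V a b = rdiag U V b a.
Proof. by rewrite /rdiag eq_sym. Qed.

Lemma roff_swap U V a b : roff V U a b = roff U V b a.
Proof. by rewrite /roff; case: ltngtP. Qed.

(** A diagonal entry of the product of [R(U, V)] with its counterpart under [q -> q^-1]. For
    [a != b] the two sides differ by a multiple of [1 - q * qi]. *)
Lemma rdiag_roff (qqi : q * qi = 1) U V a b :
  - rdiag V U a b * rdiag U V a b - roff U V a b * roff U V b a
  = (qi * U - q * V) * (q * U - qi * V).
Proof.
apply/eqP; rewrite -subr_eq0 /rdiag /roff -val_eqE; case: ltngtP => _.
- rewrite [X in X == _](_ : _ = (1 - q * qi) * (U - V) ^+ 2); last by ring.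
  by rewrite qqi subrr mul0r.
- rewrite [X in X == _](_ : _ = (1 - q * qi) * (U - V) ^+ 2); last by ring.
  by rewrite qqi subrr mul0r.
- by rewrite [X in X == _](_ : _ = 0) //; ring.
Qed.

Lemma rdiag_roffC U V a b : - rdiag V U a b * roff U V a b = roff U V a b * rdiag U V a b.
Proof.
rewrite /rdiag; case: eqP => [->|_]; last by ring.
by rewrite /roff ltnn mulr0 mul0r mulr0.
Qed.

(* Conjugating [R(u,v)] by itself: its inverse is, up to the central factor
   below, the matrix obtained by [q -> q^-1]. *)
Lemma exchange_transposed (P : algType K) U V (X Y : 'I_(2 * n) -> 'I_(2 * n) -> P) :
  q * qi = 1 -> torsion_free P -> (qi * U - q * V) * (q * U - qi * V) != 0 ->
  exchange U V X Y -> forall a b c d,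
    rdiag V U a b *: (Y b d * X a c) + roff V U b a *: (Y a d * X b c)
  = rdiag V U c d *: (X a c * Y b d) + roff V U c d *: (X a d * Y b c).
Proof.
move=> qqi tfP; set f := (X in X != 0) => f0 ex a b c d.
(* The relations for [(a, b)] and [(b, a)] form a 2 by 2 system; [elim] applies a row of its inverse
   up to the factor [f], which torsion-freeness cancels at the end. *)
have elim (r R C C' : K) (Z Z' : P) : r * R - C * C' = f -> r * C = C * R ->
    r *: (R *: Z + C *: Z') - C *: (R *: Z' + C' *: Z) = f *: Z.
  move=> <- rC; rewrite !scalerDr !scalerA rC scalerBl opprD [- _ - _]addrC.
  by rewrite addrACA subrr addr0.
have Eab := rdiag_roff qqi U V a b; have Cab := rdiag_roffC U V a b.
have Ecd := rdiag_roff qqi U V d c; have Cdc := rdiag_roffC U V d c.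
rewrite !(rdiag_sym _ _ d c) in Ecd Cdc.
have := elim _ _ _ _ (X a c * Y b d) (X b c * Y a d) Eab Cab.
have := elim _ _ _ _ (X a d * Y b c) (X b d * Y a c) Eab Cab.
have := elim _ _ _ _ (Y b d * X a c) (Y b c * X a d) Ecd Cdc.
have := elim _ _ _ _ (Y a d * X b c) (Y a c * X b d) Ecd Cdc.
have := ex a b c d; have := ex b a c d; have := ex a b d c; have := ex b a d c.
rewrite !(rdiag_sym _ _ d c) !(rdiag_sym _ _ b a) !(roff_swap U V).
move=> -> -> -> ->.
set U1 := rdiag U V c d *: _ + _; set U2 := rdiag U V c d *: _ + _.
set U3 := rdiag U V c d *: _ + _; set U4 := rdiag U V c d *: _ + _.
move=> e3 e1 f3 f1.
apply/eqP; rewrite -subr_eq0; apply/eqP/(tfP f) => //.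
clearbody f U1 U2 U3 U4; move: (rdiag V U a b) (roff U V a b) e1 e3 f1 f3 => r1 c1.
move: (rdiag V U c d) (roff U V d c) => r2 c2 e1 e3 f1 f3.
rewrite scalerBr !scalerDr !scalerA !(mulrC f) -!scalerA.
rewrite -e1 -e3 -f1 -f3 !scaleNr !(scalerBr, scalerN) !scalerA.
by apply/eqP; rewrite subr_eq0 addrACA !(mulrC r2, mulrC c2).
Qed.


Definition omegaK J M : K :=
  if odd J.+1 && (M.+1 == J.+2) then q
  else if ~~ odd J.+1 && (M.+2 == J.+1) then -1
  else 0.

(** The coefficient of [t i J * t' j L * (b a M * b' c N)] in [sseries_exchange], once the inner [b]
    and [t'] have been exchanged. *)
Definition gammaK z J L M N : K :=
  omegaK J M * omegaK L N * rdiag z 1 M L + omegaK J L * omegaK M N * roff z 1 M L.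

Lemma odd_half J : (J : nat) = (odd J + J./2.*2)%N.
Proof. by rewrite odd_double_half. Qed.

(* The constant matrix [G] itself solves the reflection equation. *)
Lemma gammaK_reflection (qqi : q * qi = 1) (x y : K) J L M N :
  gammaK (x * y) J L M N * rdiag y x J L + gammaK (x * y) L J M N * roff y x J L
  = gammaK (x * y) L J N M * rdiag y x M N + gammaK (x * y) L J M N * roff y x N M.
Proof.
(* An index is determined by its half and its parity. In these terms [omegaK] and all comparisons
   depend only on the order of the halves and on the parities, leaving finitely many polynomial
   identities. *)
have omE (A B : idx n) : omegaK A B = if A./2 == B./2 then
    (if odd A then (if odd B then 0 else -1) else if odd B then q else 0) else 0.
  rewrite /omegaK /=; have := odd_half A; have := odd_half B.
  by case: (odd A) (odd B) => [] [] /= hB hA; repeat (case: ifP => //= ?); lia.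
have ltE (A B : idx n) : (A < B)%N = (A./2 < B./2)%N || (A./2 == B./2) && (odd A < odd B)%N.
  by rewrite {1}(odd_half A) {1}(odd_half B); case: (odd A) (odd B) => [] []; lia.
have eqE (A B : idx n) : (A == B) = (A./2 == B./2) && (odd A == odd B).
  by rewrite -val_eqE /= {1}(odd_half A) {1}(odd_half B); case: (odd A) (odd B) => [] []; lia.
rewrite /gammaK /rdiag /roff !omE !ltE !eqE.
move: J./2 L./2 M./2 N./2 (odd J) (odd L) (odd M) (odd N) => j l m k eJ eL eM eN.
have close (e u v : K) : u - v = (1 - q * qi) * e -> u = v.
  by rewrite qqi subrr mul0r => /eqP; rewrite subr_eq0 => /eqP.
repeat match goal with |- context [@eq_op _ ?a ?b] =>
  is_var a; is_var b; lazymatch type of a with nat => idtac end;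
  let ab := fresh "ab" in have [ab|ab] := eqVneq a b; [subst|];
  rewrite ?eqxx ?ltnn ?mul0r ?mulr0 ?addr0 ?add0r // end.
all: repeat match goal with |- context [leq (S ?a) ?b] =>
  is_var a; is_var b; lazymatch type of a with nat => idtac end;
  case: (ltngtP a b) => ?; subst; rewrite ?eqxx ?ltnn // end.
all: repeat match goal with H : is_true (?a != ?a) |- _ => by rewrite eqxx in H end.
all: case: eJ; case: eL; case: eM; case: eN => //=; try by ring.
(* These cases hold only modulo [q * qi = 1]; the possible cofactors of [1 - q * qi] are listed. *)
all: first [ apply: (close ((qi - q) * (y - x) * (x * y))); ring
           | apply: (close (- (qi - q) * (y - x) * (x * y))); ring
           | apply: (close ((qi - q) * (y - x))); ring
           | apply: (close (- (qi - q) * (y - x))); ring ].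
Qed.

End Exchange.

(** * The reflection equation for products [T G Tbar^t] *)

Section Reflection.
Variables (n : nat) (K : comNzRingType) (q qi : K) (P : algType K).
Implicit Types (a c i j J L M N : 'I_(2 * n)) (t b : 'I_(2 * n) -> 'I_(2 * n) -> P).
Local Notation rd := (rdiag q qi).
Local Notation ro := (roff q qi).
Local Notation exchange := (exchange q qi).
Local Notation omegaK := (omegaK q).
Local Notation gammaK := (gammaK q qi).

Local Notation sum4 F := (\sum_J \sum_L \sum_M \sum_N F J L M N).

Definition sseries t b i j : P := \sum_J \sum_M omegaK J M *: (t i J * b j M).

Let sum4D (F G : 'I_(2 * n) -> 'I_(2 * n) -> 'I_(2 * n) -> 'I_(2 * n) -> P) :
  sum4 F + sum4 G = sum4 (fun J L M N => F J L M N + G J L M N).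
Proof. by do 4!(rewrite -big_split; apply: eq_bigr => ? _). Qed.

Let sum4Z (k : K) (F : 'I_(2 * n) -> 'I_(2 * n) -> 'I_(2 * n) -> 'I_(2 * n) -> P) :
  k *: sum4 F = sum4 (fun J L M N => k *: F J L M N).
Proof. by do 4!(rewrite scaler_sumr; apply: eq_bigr => ? _). Qed.

Let eq_sum4 (F G : 'I_(2 * n) -> 'I_(2 * n) -> 'I_(2 * n) -> 'I_(2 * n) -> P) :
  (forall J L M N, F J L M N = G J L M N) -> sum4 F = sum4 G.
Proof. by move=> FG; do 4!(apply: eq_bigr => ? _). Qed.

Lemma sseries_mul t b t' b' i a j c :
  sseries t b i a * sseries t' b' j c
  = sum4 (fun J L M N => (omegaK J M * omegaK L N) *: (t i J * (b a M * t' j L) * b' c N)).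
Proof.
rewrite /sseries big_distrl; apply: eq_bigr => J _ /=.
rewrite [RHS]exchange_big big_distrl; apply: eq_bigr => M _; rewrite big_distrr.
apply: eq_bigr => L _; rewrite big_distrr; apply: eq_bigr => N _ /=.
by rewrite -!scalerAr -!scalerAl scalerA mulrC !mulrA.
Qed.

(** The relation between [b] and [t'] is applied in the middle of each product, bringing both [t]
    factors to the left. *)
Lemma sseries_exchange t b t' b' z : exchange z 1 b t' -> forall i j a c,
  rd z 1 a j *: (sseries t b i a * sseries t' b' j c)
  + ro z 1 a j *: (sseries t b i j * sseries t' b' a c)
  = sum4 (fun J L M N => gammaK z J L M N *: (t i J * t' j L * (b a M * b' c N))).
Proof.
move=> ex i j a c; rewrite !sseries_mul !sum4Z sum4D.
pose F J L M N := (omegaK J M * omegaK L N * rd z 1 M L) *: (t i J * t' j L * (b a M * b' c N)).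
pose G J L M N := (omegaK J M * omegaK L N * ro z 1 L M) *: (t i J * t' j M * (b a L * b' c N)).
transitivity (sum4 F + sum4 G).
  have lin (k k' w : K) (u v p p' : P) : k *: (w *: (p * u * p')) + k' *: (w *: (p * v * p'))
      = w *: (p * (k *: u + k' *: v) * p').
    by rewrite mulrDr mulrDl scalerDr -!scalerAr -!scalerAl !scalerA !(mulrC w).
  rewrite sum4D; apply: eq_sum4 => J L M N; rewrite /F /G lin ex -lin !scalerA !mulrA.
  by congr (_ *: _ + _ *: _); rewrite /roff; ring.
rewrite [X in _ + X = _](_ : _ = sum4 (fun J L M N => G J M L N)); last first.
  by apply: eq_bigr => J _; rewrite exchange_big.
by rewrite sum4D; apply: eq_sum4 => J L M N; rewrite -scalerDl.
Qed.

(** Both sides are expanded by [sseries_exchange]. On the left the [t] factors are exchanged,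
    [gammaK_reflection] moves the scalars across, and the transposed relation for the [b] factors
    turns the result into the right side. *)
Lemma reflection t b t' b' x y : q * qi = 1 ->
  exchange y x t t' -> exchange (x * y) 1 b t' -> exchange (x * y) 1 b' t ->
  (forall a c M N,
     rd y x a c *: (b' c N * b a M) + ro y x c a *: (b' a N * b c M)
   = rd y x M N *: (b a M * b' c N) + ro y x M N *: (b a N * b' c M)) ->
  let z := x * y in let s := sseries t b in let s' := sseries t' b' in
  forall i j a c,
    rd y x i j *: (rd z 1 a j *: (s i a * s' j c) + ro z 1 a j *: (s i j * s' a c))
  + ro y x i j *: (rd z 1 a i *: (s j a * s' i c) + ro z 1 a i *: (s j i * s' a c))
  = rd y x a c *: (rd z 1 c i *: (s' j c * s i a) + ro z 1 c i *: (s' j i * s c a))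
  + ro y x c a *: (rd z 1 a i *: (s' j a * s i c) + ro z 1 a i *: (s' j i * s a c)).
Proof.
move=> qqi tt bt b't bb z s s' i j a c.
rewrite !(@sseries_exchange t b t' b' z bt) !(@sseries_exchange t' b' t b z b't) !sum4Z !sum4D.
have linl (k k' w : K) (u v p : P) :
    k *: (w *: (u * p)) + k' *: (w *: (v * p)) = w *: ((k *: u + k' *: v) * p).
  by rewrite mulrDl scalerDr -!scalerAl !scalerA !(mulrC w).
have linr (k k' w : K) (u v p : P) :
    k *: (w *: (p * u)) + k' *: (w *: (p * v)) = w *: (p * (k *: u + k' *: v)).
  by rewrite mulrDr scalerDr -!scalerAr !scalerA !(mulrC w).
pose X J L M N := t' j L * t i J * (b a M * b' c N).
transitivity (sum4 (fun J L M N =>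
    (gammaK z J L M N * rd y x J L + gammaK z L J M N * ro y x J L) *: X J L M N)).
  pose F J L M N := (gammaK z J L M N * rd y x J L) *: X J L M N.
  pose G J L M N := (gammaK z L J M N * ro y x J L) *: X J L M N.
  transitivity (sum4 F + sum4 G); last first.
    by rewrite sum4D; apply: eq_sum4 => J L M N; rewrite -scalerDl.
  rewrite [X in _ = _ + X]exchange_big sum4D; apply: eq_sum4 => J L M N; rewrite /F /G /X.
  by rewrite linl tt -linl !scalerA !(mulrC (gammaK _ _ _ _ _)).
transitivity (sum4 (fun J L M N =>
    (gammaK z L J N M * rd y x M N + gammaK z L J M N * ro y x N M) *: X J L M N)).
  by apply: eq_sum4 => J L M N; rewrite gammaK_reflection.
pose F J L M N := (gammaK z L J N M * rd y x M N) *: X J L M N.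
pose G J L M N := (gammaK z L J M N * ro y x N M) *: X J L M N.
transitivity (sum4 F + sum4 G).
  by rewrite sum4D; apply: eq_sum4 => J L M N; rewrite -scalerDl.
rewrite exchange_big [X in _ + X]exchange_big sum4D.
apply: eq_bigr => L _; apply: eq_bigr => J _.
transitivity (\sum_M \sum_N (F J L M N + G J L N M)).
  transitivity (\sum_M \sum_N F J L M N + \sum_M \sum_N G J L M N).
    by rewrite -big_split; apply: eq_bigr => M _; rewrite big_split.
  rewrite [X in _ + X]exchange_big -big_split; apply: eq_bigr => M _.
  by rewrite big_split.
rewrite exchange_big; apply: eq_bigr => N _; apply: eq_bigr => M _.
by rewrite /F /G /X linr bb -linr !scalerA !(mulrC (gammaK _ _ _ _ _)).
Qed.
End Reflection.

(** * The defining relations coefficient by coefficient *)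

Section RTT.
Variables (n : nat) (q : CC).
Implicit Types (a b c d i j k J L M N : 'I_(2 * n)).

(** The entries of [R(u, v)] split by variable: [adiag] and [aoff] multiply [u], [bdiag] and [boff]
    multiply [v]. *)
Definition adiag a b : CC := if a == b then q^-1 else 1.
Definition bdiag a b : CC := if a == b then - q else -1.
Definition aoff a b : CC := if (b < a)%N then q^-1 - q else 0.
Definition boff a b : CC := if (a < b)%N then q^-1 - q else 0.

Lemma RalphaE (V : lmodType CC) a b c d (v : V) : Ralpha q a b c d *: v =
  (if (c == a) && (d == b) then adiag a b *: v else 0)
  + (if (c == b) && (d == a) then aoff a b *: v else 0).
Proof.
rewrite /Ralpha /adiag /aoff ![c == _]eq_sym ![d == _]eq_sym andbAC [(b == c) && _]andbC.
have [->|ab] := eqVneq a b.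
  by rewrite ltnn andbF !scale0r if_same addr0; case: ifP; rewrite ?scale0r.
rewrite andbT; case: ifP => [/andP[/eqP <- /eqP <-]|_].
  by rewrite (negbTE ab) addr0.
by rewrite add0r; case: ifP; rewrite ?scale0r.
Qed.

Lemma RbetaE (V : lmodType CC) a b c d (v : V) : Rbeta q a b c d *: v =
  (if (c == a) && (d == b) then bdiag a b *: v else 0)
  + (if (c == b) && (d == a) then boff a b *: v else 0).
Proof.
rewrite /Rbeta /bdiag /boff ![c == _]eq_sym ![d == _]eq_sym andbAC [(b == c) && _]andbC.
have [->|ab] := eqVneq a b.
  by rewrite ltnn andbF !scale0r if_same addr0; case: ifP; rewrite ?scale0r.
rewrite andbT; case: ifP => [/andP[/eqP <- /eqP <-]|_].
  by rewrite (negbTE ab) addr0.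
by rewrite add0r; case: ifP; rewrite ?scale0r.
Qed.

Lemma sum_if_pair (V : nmodType) (a b : idx n) (F : idx n -> idx n -> V) :
  \sum_i \sum_k (if (i == a) && (k == b) then F i k else 0) = F a b.
Proof.
rewrite (bigD1 a) //= [X in _ + X]big1 ?addr0 => [|i /negbTE ia]; last first.
  by apply: big1 => k _; rewrite ia.
rewrite (bigD1 b) //= !eqxx big1 ?addr0 // => k /negbTE kb.
by rewrite kb andbF.
Qed.

Lemma sum_Rrow (V : lmodType CC) a b (F G : idx n -> idx n -> V) :
  \sum_i \sum_k (Ralpha q a b i k *: F i k + Rbeta q a b i k *: G i k)
  = adiag a b *: F a b + bdiag a b *: G a b + (aoff a b *: F b a + boff a b *: G b a).
Proof.
under eq_bigr do under eq_bigr do rewrite RalphaE RbetaE addrACA.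
under eq_bigr do rewrite big_split !big_split /=.
by rewrite !big_split /= !sum_if_pair.
Qed.

Lemma sum_Rcol (V : lmodType CC) c d (F G : idx n -> idx n -> V) :
  \sum_i \sum_k (Ralpha q i k c d *: F i k + Rbeta q i k c d *: G i k)
  = adiag c d *: F c d + bdiag c d *: G c d + (aoff d c *: F d c + boff d c *: G d c).
Proof.
under eq_bigr => i _ do under eq_bigr => k _ do
  rewrite RalphaE RbetaE addrACA ![c == _]eq_sym ![d == _]eq_sym ![(k == c) && _]andbC.
under eq_bigr do rewrite big_split !big_split /=.
by rewrite !big_split /= !sum_if_pair.
Qed.

Lemma RTT_relE (A : algType CC) (X Y : idx n -> idx n -> int -> A) :
  RTT_rel q X Y -> forall a b c d m p,
  adiag a b *: (X a c (m - 1) * Y b d p) + bdiag a b *: (X a c m * Y b d (p - 1))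
  + (aoff a b *: (X b c (m - 1) * Y a d p) + boff a b *: (X b c m * Y a d (p - 1)))
  = adiag c d *: (Y b d p * X a c (m - 1)) + bdiag c d *: (Y b d (p - 1) * X a c m)
  + (aoff d c *: (Y b c p * X a d (m - 1)) + boff d c *: (Y b c (p - 1) * X a d m)).
Proof. by move=> rel a b c d m p; have := rel a b c d m p; rewrite sum_Rrow sum_Rcol. Qed.

Lemma Tser_opp (T : Type) (z : T) (t : idx n -> idx n -> nat -> T) i j (m : nat) :
  Tser z t i j (- m%:Z) = t i j m.
Proof. by case: m. Qed.
Lemma Tser_1opp (T : Type) (z : T) (t : idx n -> idx n -> nat -> T) i j (m : nat) :
  Tser z t i j (1 - m%:Z) = if m is m'.+1 then t i j m' else z.
Proof.
case: m => [|m] //=; have -> : (1 - m.+1%:Z)%R = (- m%:Z)%R by lia.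
exact: Tser_opp.
Qed.
Lemma TBser_sub1 (T : Type) (z : T) (t : idx n -> idx n -> nat -> T) i j (m : nat) :
  TBser z t i j (m%:Z - 1) = if m is m'.+1 then t i j m' else z.
Proof.
case: m => [|m] //; have -> // : (m.+1%:Z - 1)%R = (m%:Z)%R by lia.
Qed.
End RTT.

(* The variables are [x = u^-1] and [y = v^-1], so that every series is a power
   series in nonnegative powers; a series in [y] is one with coefficients in
   [ps R]. *)
HB.lock Definition vx : ps (ps CC) := psC psX.
HB.lock Definition vy : ps (ps CC) := psX.
HB.lock Definition kc (c : CC) : ps (ps CC) := psC (psC c).
Definition px (R : zmodType) (f : nat -> R) : ps (ps R) := psC (Ps f).
Definition py (R : zmodType) (f : nat -> R) : ps (ps R) := Ps (fun p => psC (f p)).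

Section Coefs.
Variable A : algType CC.
Implicit Types (F : ps (ps A)) (f g : nat -> A).

Lemma vxZE F p m : (vx *: F) p m = if m is m'.+1 then F p m' else 0.
Proof. by rewrite vx.unlock psCZE psXZE. Qed.
Lemma vyZE F p m : (vy *: F) p m = if p is p'.+1 then F p' m else 0.
Proof. by rewrite vy.unlock psXZE; case: p. Qed.
Lemma kcZE c F p m : (kc c *: F) p m = c *: F p m.
Proof. by rewrite kc.unlock !psCZE. Qed.

Lemma psC_mull (R : nzRingType) (r : R) (f : ps R) n : (psC r * f) n = r * f n.
Proof.
rewrite psME big_ord_recl /= subn0 big1 ?addr0 // => i _; by rewrite mul0r.
Qed.
Lemma psC_mulr (R : nzRingType) (r : R) (f : ps R) n : (f * psC r) n = f n * r.
Proof.
rewrite psME big_ord_recr /= subnn big1 ?add0r // => [[i lti]] _ /=.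
by rewrite -(subnSK lti) mulr0.
Qed.
Lemma psCM (R : nzRingType) : {morph @psC R : r s / r * s}.
Proof. by move=> r s; apply/psP => -[|n]; rewrite psC_mull //= mulr0. Qed.

Lemma pxyE f g p m : (px f * py g) p m = f m * g p.
Proof. by rewrite psC_mull psC_mulr. Qed.
Lemma pyxE f g p m : (py g * px f) p m = g p * f m.
Proof. by rewrite psC_mulr psC_mull. Qed.
Lemma pxM f g : px f * px g = px (fun m => \sum_(l < m.+1) f l * g (m - l)%N).
Proof. by rewrite /px -psCM; congr psC; apply/psP => m; rewrite psME. Qed.
Lemma pyM f g : py f * py g = py (fun m => \sum_(l < m.+1) f l * g (m - l)%N).
Proof.
apply/psP => p; apply/psP => m; rewrite psME ps_sumE.
transitivity (\sum_(i < p.+1) psC (f i * g (p - i)%N) m).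
  by apply: eq_bigr => i _; rewrite psCM.
by case: m => [|m] //=; rewrite big1.
Qed.
End Coefs.

Lemma ps_domain (R : nzRingType) :
  (forall a b : R, a != 0 -> a * b = 0 -> b = 0) ->
  forall f g : ps R, f != 0 -> f * g = 0 -> g = 0.
Proof.
move=> dom f g f0 fg; apply: (@ps_torsion_free R R^o dom f g f0).
by apply/psP => n; rewrite psZE; move/psP/(_ n): fg; rewrite psME.
Qed.

Lemma ps2_mulf_neq0 (F G : ps (ps CC)) : F != 0 -> G != 0 -> F * G != 0.
Proof.
move=> F0; apply: contraNN => /eqP FG; apply/eqP; apply: ps_domain F0 FG.
by apply: ps_domain => a b a0 /eqP; rewrite mulf_eq0 (negbTE a0) => /eqP.
Qed.

Lemma ps2_neq0 (F : ps (ps CC)) p m : F p m != 0 -> F != 0.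
Proof. by apply: contraNN => /eqP ->. Qed.

Lemma kc_mulE c (F : ps (ps CC)) p m : (kc c * F) p m = c * F p m.
Proof. by rewrite kc.unlock !psC_mull. Qed.

Lemma vxE p m : vx p m = ((p == 0%N) && (m == 1%N))%:R.
Proof. by rewrite vx.unlock; case: p => [|p]. Qed.

Lemma vyE p m : vy p m = ((p == 1%N) && (m == 0%N))%:R.
Proof. by rewrite vy.unlock /=; case: eqP => _ //; case: m. Qed.

Lemma ps2_mul00 (F G : ps (ps CC)) : (F * G) 0%N 0%N = F 0%N 0%N * G 0%N 0%N.
Proof. by rewrite !(psME, big_ord1). Qed.

Lemma kcM : {morph kc : c e / c * e}.
Proof. by move=> c e; rewrite kc.unlock !psCM. Qed.
Lemma kcB : {morph kc : c e / c - e}.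
Proof.
have h (V : zmodType) : {morph @psC V : u v / u - v}.
  by move=> u v; apply/psP => -[|m]; rewrite psBE //= subr0.
by move=> c e; rewrite kc.unlock !h.
Qed.
Lemma kc1 : kc 1 = 1. Proof. by rewrite kc.unlock. Qed.
Lemma kc0 : kc 0 = 0. Proof. by rewrite -(subrr 0) kcB subrr. Qed.
Lemma kcN : {morph kc : c / - c}.
Proof. by move=> c; rewrite -sub0r kcB kc0 sub0r. Qed.

(** * Exchange and reflection relations in a model *)

Section Model.
Variables (n : nat) (q : CC) (A : algType CC).
Implicit Types (a b c d i j k J L M N : 'I_(2 * n)).
Local Notation rd := (rdiag (kc q) (kc q^-1)).
Local Notation ro := (roff (kc q) (kc q^-1)).

Lemma rdiagE U V a b : rd U V a b = kc (adiag q a b) * U + kc (bdiag q a b) * V.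
Proof.
by rewrite /rdiag /adiag /bdiag; case: ifP => _; rewrite kcN ?kc1; ring.
Qed.
Lemma roffE U V a b : ro U V a b = kc (aoff q a b) * U + kc (boff q a b) * V.
Proof.
by rewrite /roff /aoff /boff; case: ltngtP => _; rewrite ?kcB ?kc0; ring.
Qed.

Variable M : Uext_model n A.
Hypothesis mM : is_Uext_model q M.
Local Notation tx := (fun i j => px (tt M i j)).
Local Notation ty := (fun i j => py (tt M i j)).
Local Notation bx := (fun i j => px (tb M i j)).
Local Notation bY := (fun i j => py (tb M i j)).
Local Notation exchange := (exchange (kc q) (kc q^-1)).

(** [R] is homogeneous of degree one, so [R(x^-1, y^-1)] times [x y] is [R(y, x)]: the arguments
    appear swapped. *)
Lemma exchange_tt : exchange vy vx tx ty.
Proof.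
move=> a b c d; apply/psP => p; apply/psP => m; rewrite !rdiagE !roffE.
rewrite !scalerDl -!scalerA !psDE !kcZE !vxZE !vyZE.
(* This is the coefficient of [u^(1 - m) v^(1 - p)]. For [m = 0] or [p = 0] the coefficient of a
   positive power is the default [0] of [Tser], just as multiplication by [x] or [y] leaves no
   constant term. *)
case: mM => _ _ _ _ [/RTT_relE/(_ a b c d (1 - m%:Z) (1 - p%:Z)) + _ _].
rewrite ![1 - _ - 1]addrAC subrr !sub0r !Tser_opp !Tser_1opp.
by case: p => [|p]; case: m => [|m]; rewrite ?pxyE ?pyxE ?mul0r ?mulr0 ?scaler0.
Qed.
Lemma exchange_bb : exchange vx vy bx bY.
Proof.
move=> a b c d; apply/psP => p; apply/psP => m; rewrite !rdiagE !roffE.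
rewrite !scalerDl -!scalerA !psDE !kcZE !vxZE !vyZE.
case: mM => _ _ _ _ [_ /RTT_relE/(_ a b c d m%:Z p%:Z) + _].
rewrite !TBser_sub1.
by case: p => [|p]; case: m => [|m]; rewrite ?pxyE ?pyxE ?mul0r ?mulr0 ?scaler0.
Qed.
(** Here [R] has arguments [x] and [y^-1]; multiplying by [y] gives [R(x y, 1)]. *)
Lemma exchange_bt : exchange (vx * vy) 1 bx ty.
Proof.
move=> a b c d; apply/psP => p; apply/psP => m; rewrite !rdiagE !roffE.
rewrite !scalerDl !mulr1 -!scalerA !psDE !kcZE !vxZE.
case: mM => _ _ _ _ [_ _ /RTT_relE/(_ a b c d m%:Z (1 - p%:Z))].
rewrite ![1 - _ - 1]addrAC subrr !sub0r !Tser_opp !Tser_1opp !TBser_sub1.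
by case: p => [|p]; case: m => [|m]; rewrite ?vyZE ?pxyE ?pyxE ?mul0r ?mulr0 ?scaler0.
Qed.
Lemma exchange_bt' : exchange (vx * vy) 1 bY tx.
Proof.
move=> a b c d; apply/psP => p; apply/psP => m; rewrite !rdiagE !roffE.
rewrite !scalerDl !mulr1 -!scalerA !psDE !kcZE !vxZE.
case: mM => _ _ _ _ [_ _ /RTT_relE/(_ a b c d p%:Z (1 - m%:Z))].
rewrite ![1 - _ - 1]addrAC subrr !sub0r !Tser_opp !Tser_1opp !TBser_sub1.
by case: p => [|p]; case: m => [|m]; rewrite ?vyZE ?pxyE ?pyxE ?mul0r ?mulr0 ?scaler0.
Qed.

Lemma omega_kc J L : omegaK (kc q) J L = kc (omega q J L).
Proof. by rewrite /omegaK /omega; case: ifP => //; case: ifP; rewrite ?kcN ?kc1 ?kc0. Qed.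

Lemma sseries_px i j : sseries (kc q) tx bx i j = px (s_coef q M i j).
Proof.
apply/psP => p; apply/psP => m; rewrite /sseries.
under eq_bigr do under eq_bigr do rewrite omega_kc pxM.
rewrite !ps_sumE; under eq_bigr do rewrite !ps_sumE.
under eq_bigr do under eq_bigr do rewrite kcZE.
case: p => [|p] /=; last by rewrite big1 // => J _; rewrite big1 // => L _; rewrite scaler0.
rewrite /s_coef; under eq_bigr do under eq_bigr do rewrite scaler_sumr.
rewrite [RHS]exchange_big; apply: eq_bigr => J _.
by rewrite [RHS]exchange_big.
Qed.
Lemma sseries_py i j : sseries (kc q) ty bY i j = py (s_coef q M i j).
Proof.
apply/psP => p; apply/psP => m; rewrite /sseries.
under eq_bigr do under eq_bigr do rewrite omega_kc pyM.
rewrite !ps_sumE; under eq_bigr do rewrite !ps_sumE.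
under eq_bigr do under eq_bigr do rewrite kcZE.
case: m => [|m] /=; last by rewrite big1 // => J _; rewrite big1 // => L _; rewrite scaler0.
rewrite /s_coef; under eq_bigr do under eq_bigr do rewrite scaler_sumr.
rewrite [RHS]exchange_big; apply: eq_bigr => J _.
by rewrite [RHS]exchange_big.
Qed.

(** The family [S] is arbitrary, so that the same expression can be evaluated in models and in a
    representation. *)
Definition reflection_defect (S : idx n -> idx n -> nat -> A) i j a c : ps (ps A) :=
  let z := vx * vy in let s i j := px (S i j) in let s' i j := py (S i j) in
  let r := rd vy vx in let o := ro vy vx in
  let r' := rd z 1 in let o' := ro z 1 in
  r i j *: (r' a j *: (s i a * s' j c) + o' a j *: (s i j * s' a c))
  + o i j *: (r' a i *: (s j a * s' i c) + o' a i *: (s j i * s' a c))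
  - (r a c *: (r' c i *: (s' j c * s i a) + o' c i *: (s' j i * s c a))
     + o c a *: (r' a i *: (s' j a * s i c) + o' a i *: (s' j i * s a c))).

Lemma model_reflection : q != 0 -> forall i j a c,
  reflection_defect (s_coef q M) i j a c = 0.
Proof.
move=> q0 i j a c; apply/eqP; rewrite subr_eq0; apply/eqP.
rewrite -!sseries_px -!sseries_py.
have qqi : kc q * kc q^-1 = 1 by rewrite -kcM mulfV ?kc1.
apply: (reflection qqi exchange_tt exchange_bt exchange_bt').
apply: (exchange_transposed qqi _ _ exchange_bb).
  apply: ps_torsion_free; apply: ps_torsion_free => k v k0 /eqP.
  by rewrite scaler_eq0 (negbTE k0) => /eqP.
(* The coefficient of [x] is [q^-1] in the first factor and [q] in the second. *)
apply: ps2_mulf_neq0; apply: (@ps2_neq0 _ 0 1); rewrite !psBE !kc_mulE vxE vyE /=.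
  by rewrite mulr1 mulr0 subr0 invr_neq0.
by rewrite mulr1 mulr0 subr0.
Qed.
End Model.

(** * Weights of the generators *)

Section ModelWeights.
Variables (n : nat) (q : CC) (A : algType CC) (M : Uext_model n A).
Hypotheses (q0 : q != 0) (mM : is_Uext_model q M).
Implicit Types (b d i k l J L : 'I_(2 * n)) (a : 'I_n).

Definition qdelta k i : CC := if k == i then q else 1.
(** This is [q] at [oidx a], [q^-1] at [eidx a] and [1] elsewhere; conjugation by [kcart a]
    multiplies [t_bd] by [weight a b / weight a d]. *)
Definition weight a k : CC := qdelta k (oidx a) / qdelta k (eidx a).

Lemma qdelta_neq0 k i : qdelta k i != 0.
Proof. by rewrite /qdelta; case: ifP => // _; apply: oner_neq0. Qed.
Lemma weight_neq0 a k : weight a k != 0.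
Proof. by rewrite mulf_neq0 ?invr_neq0 ?qdelta_neq0. Qed.

Let tt0 (i j : idx n) : (i < j)%N -> tt M i j 0%N = 0.
Proof. by case: mM => tri _ _ _ _ /tri[]. Qed.
Let tb0 (i j : idx n) : (i < j)%N -> tb M j i 0%N = 0.
Proof. by case: mM => tri _ _ _ _ /tri[]. Qed.

Let adiagE i b : adiag q i b = (qdelta b i)^-1.
Proof. by rewrite /adiag /qdelta eq_sym; case: ifP => // _; rewrite invr1. Qed.
Let bdiagE i b : bdiag q i b = - qdelta b i.
Proof. by rewrite /bdiag /qdelta eq_sym; case: ifP. Qed.
Let bdiagE' i b : bdiag q b i = - qdelta b i.
Proof. by rewrite /bdiag /qdelta; case: ifP. Qed.

Let off0 (b0 : bool) (c : CC) (v : A) : (b0 -> v = 0) -> (if b0 then c else 0) *: v = 0.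
Proof. by case: b0 => [->|_] //; rewrite ?scaler0 ?scale0r. Qed.
Let Tser_0 (t : idx n -> idx n -> nat -> A) i j : Tser 0 t i j 0 = t i j 0%N. Proof. by []. Qed.
Let Tser_1 (t : idx n -> idx n -> nat -> A) i j : Tser 0 t i j 1 = 0. Proof. by []. Qed.

Let TBser_0 (t : idx n -> idx n -> nat -> A) i j : TBser 0 t i j 0%N%:Z = t i j 0%N.
Proof. by []. Qed.

Lemma tt0_tt i b d r : tt M i i 0%N * tt M b d r
  = (qdelta b i / qdelta d i) *: (tt M b d r * tt M i i 0%N).
Proof.
(* At [m = 1] the coefficient of [u] in [t(u)] vanishes, and triangularity of the [t^(0)] removes
   the off-diagonal terms, so one product remains on each side. *)
case: mM => _ _ _ _ [/RTT_relE/(_ i b i d 1 (- r%:Z)) + _ _].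
rewrite subrr Tser_0 !Tser_1 !Tser_opp !mul0r !mulr0 !scaler0 !addr0.
rewrite /aoff !off0; try by move=> /tt0 h; rewrite ?[Tser _ _ _ _ 0]h ?h ?mul0r ?mulr0.
rewrite !addr0 !adiagE.
move=> /(congr1 ( *:%R (qdelta b i))).
by rewrite !scalerA divff ?qdelta_neq0 // scale1r.
Qed.

Let qdeltaZ (b d i : idx n) (u v : A) : - qdelta b i *: u = - qdelta d i *: v ->
  u = (qdelta d i / qdelta b i) *: v.
Proof.
rewrite !scaleNr => /oppr_inj/(congr1 ( *:%R (qdelta b i)^-1)).
by rewrite !scalerA mulVf ?qdelta_neq0 // scale1r mulrC.
Qed.

Lemma tt0_tb i b d r : tt M i i 0%N * tb M b d r
  = (qdelta b i / qdelta d i) *: (tb M b d r * tt M i i 0%N).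
Proof.
case: mM => _ _ _ _ [_ _ /RTT_relE/(_ b i d i r%:Z 1)].
rewrite subrr !Tser_0 !Tser_1 !mul0r !mulr0 !scaler0 !add0r /boff.
rewrite !off0; try by move=> /tt0 h; rewrite ?[Tser _ _ _ _ 0]h ?h ?mul0r ?mulr0.
rewrite !addr0 !bdiagE'.
by move/esym/qdeltaZ.
Qed.

Lemma tb0_tb i b d r : tb M i i 0%N * tb M b d r
  = (qdelta d i / qdelta b i) *: (tb M b d r * tb M i i 0%N).
Proof.
case: mM => _ _ _ _ [_ /RTT_relE/(_ i b i d 0%N%:Z r.+1%:Z) + _].
rewrite !TBser_sub1 !TBser_0 !mul0r !mulr0 !scaler0 !add0r /boff.
rewrite !off0; try by move=> /tb0 h; rewrite ?h ?mul0r ?mulr0.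
by rewrite !addr0 !bdiagE => /qdeltaZ.
Qed.

Lemma tb0_tt i b d r : tb M i i 0%N * tt M b d r
  = (qdelta d i / qdelta b i) *: (tt M b d r * tb M i i 0%N).
Proof.
case: mM => _ _ _ _ [_ _ /RTT_relE/(_ i b i d 0%N%:Z (1 - r%:Z))].
rewrite !TBser_sub1 !TBser_0 ![1 - _ - 1]addrAC subrr !sub0r !Tser_opp.
rewrite !mul0r !mulr0 !scaler0 !add0r /boff.
rewrite !off0; try by move=> /tb0 h; rewrite ?h ?mul0r ?mulr0.
by rewrite !addr0 !bdiagE => /qdeltaZ.
Qed.

Definition kcart a : A := tt M (oidx a) (oidx a) 0%N * tb M (eidx a) (eidx a) 0%N.

Lemma kcart_tt a b d r : kcart a * tt M b d r = (weight a b / weight a d) *: (tt M b d r * kcart a).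
Proof.
rewrite /kcart -mulrA tb0_tt -scalerAr (mulrA (tt M (oidx a) _ _)) tt0_tt -scalerAl scalerA mulrA.
by congr (_ *: _); rewrite /weight !invfM !invrK; ring.
Qed.
Lemma kcart_tb a b d r : kcart a * tb M b d r = (weight a b / weight a d) *: (tb M b d r * kcart a).
Proof.
rewrite /kcart -mulrA tb0_tb -scalerAr (mulrA (tt M (oidx a) _ _)) tt0_tb -scalerAl scalerA mulrA.
by congr (_ *: _); rewrite /weight !invfM !invrK; ring.
Qed.

(** [G] only joins the two members of a pair [2a-1, 2a], whose weights are inverse to each other;
    hence the summation indices in [s_kl] do not affect its weight. *)
Lemma weight_omega a J L : omega q J L != 0 -> weight a J * weight a L = 1.
Proof.
have pair (i j : nat) : ~~ odd i -> j = i.+1 ->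
    (if i == a.*2 then q else 1) / (if i == a.*2.+1 then q else 1)
    * ((if j == a.*2 then q else 1) / (if j == a.*2.+1 then q else 1)) = 1.
  move=> oi ->; have -> : (i == a.*2.+1) = false by lia.
  have -> : (i.+1 == a.*2) = false by lia.
  rewrite eqSS; case: ifP => _; rewrite ?divr1 ?mulr1 // mul1r divff //.
rewrite /omega /weight /qdelta -!val_eqE /=.
case: ifP => [/andP[oJ /eqP[L1]] _|_]; first exact: pair.
case: ifP => [/andP[oJ /eqP[L1]] _|_]; last by rewrite eqxx.
by rewrite mulrC pair //; lia.
Qed.

Lemma kcart_conv (X Y : idx n -> idx n -> nat -> A) a k l r :
  (forall b d r', kcart a * X b d r' = (weight a b / weight a d) *: (X b d r' * kcart a)) ->
  (forall b d r', kcart a * Y b d r' = (weight a b / weight a d) *: (Y b d r' * kcart a)) ->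
  let s := \sum_(m < r.+1) \sum_J \sum_L omega q J L *: (X k J m * Y l L (r - m)%N) in
  kcart a * s = (weight a k * weight a l) *: (s * kcart a).
Proof.
move=> hX hY; rewrite /= mulr_sumr mulr_suml scaler_sumr; apply: eq_bigr => m _.
rewrite mulr_sumr mulr_suml scaler_sumr; apply: eq_bigr => J _.
rewrite mulr_sumr mulr_suml scaler_sumr; apply: eq_bigr => L _.
have [->|/(weight_omega a) w1] := eqVneq (omega q J L) 0.
  by rewrite !scale0r mul0r mulr0 scaler0.
rewrite -scalerAr -!(scalerAl (omega q J L)) mulrA hX -scalerAl -(mulrA (X _ _ _) (kcart a)) hY -scalerAr mulrA.
rewrite !(scalerA (omega q J L)) !(scalerA (_ * weight a l)) scalerA.
congr (_ *: _).
transitivity (omega q J L * (weight a k * weight a l) / (weight a J * weight a L)).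
  by rewrite -mulrA mulf_div mulrA.
by rewrite w1 divr1 mulrC.
Qed.

Lemma kcart_s a k l r : kcart a * s_coef q M k l r
  = (weight a k * weight a l) *: (s_coef q M k l r * kcart a).
Proof. exact: kcart_conv (kcart_tt a) (kcart_tb a). Qed.
Lemma kcart_sbar a k l r : kcart a * sbar_coef q M k l r
  = (weight a k * weight a l) *: (sbar_coef q M k l r * kcart a).
Proof. exact: kcart_conv (kcart_tb a) (kcart_tt a). Qed.

Let sum_one (F : idx n -> idx n -> A) (i j : idx n) :
  (forall k l, (k != i) || (l != j) -> F k l = 0) -> \sum_k \sum_l F k l = F i j.
Proof.
move=> F0; rewrite (bigD1 i) //= (bigD1 j) //= !big1 ?addr0 // => k ki.
  by apply: big1 => l _; rewrite F0 ?ki.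
by rewrite F0 // ki orbT.
Qed.

(** Triangularity forces [J <= oidx a] and [eidx a <= L], and [omega] vanishes unless [J] and [L]
    are neighbours, so a single summand survives. *)
Lemma s_coef_kcart a : s_coef q M (oidx a) (eidx a) 0 = q *: kcart a.
Proof.
rewrite /s_coef big_ord1 /= (sum_one (i := oidx a) (j := eidx a)) => [|J L JL].
  by rewrite /omega /= odd_double eqxx.
have [oJ|Jo] := ltnP (oidx a) J; first by rewrite tt0 // mul0r scaler0.
have [Le|eL] := ltnP L (eidx a); first by rewrite tb0 // mulr0 scaler0.
move: JL Jo eL; rewrite /omega -!val_eqE /=.
do 2?case: ifP => ?; rewrite ?scale0r //; lia.
Qed.
Lemma sbar_coef_kcart a : sbar_coef q M (eidx a) (oidx a) 0
  = - (tb M (eidx a) (eidx a) 0%N * tt M (oidx a) (oidx a) 0%N).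
Proof.
rewrite /sbar_coef big_ord1 /= (sum_one (i := eidx a) (j := oidx a)) => [|J L JL].
  by rewrite /omega /= odd_double eqxx scaleN1r.
have [oJ|Jo] := ltnP J (eidx a); first by rewrite tb0 // mul0r scaler0.
have [Le|eL] := ltnP (oidx a) L; first by rewrite tt0 // mulr0 scaler0.
move: JL Jo eL; rewrite /omega -!val_eqE /=.
do 2?case: ifP => ?; rewrite ?scale0r //; lia.
Qed.
Lemma kcartC a : tb M (eidx a) (eidx a) 0%N * tt M (oidx a) (oidx a) 0%N = kcart a.
Proof. by rewrite tb0_tt divff ?qdelta_neq0 // scale1r. Qed.

Lemma sinv_kcart a : sinv q M a * s_coef q M (oidx a) (eidx a) 0 = 1
  /\ s_coef q M (oidx a) (eidx a) 0 * sinv q M a = 1.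
Proof.
case: mM => _ _ /(_ (oidx a)) [t1 t2] /(_ (eidx a)) [b1 b2] _.
rewrite s_coef_kcart /sinv /kcart -!scalerAl -!scalerAr !scalerA mulVf // mulfV // !scale1r.
by rewrite !mulrA -(mulrA (tbinv M _)) t1 mulr1 b1 -(mulrA (tt M _ _ _)) b2 mulr1 t2.
Qed.
End ModelWeights.

(** * Transfer to a representation *)

Definition ysum n r (F : nat -> yterm n) : yterm n :=
  foldr (fun k => @YAdd n (F k)) (YC n 0) (iota 0 r).

Lemma yeval_ysum n (A : algType CC) (gS : idx n -> idx n -> nat -> A) (gI : 'I_n -> A) r F :
  yeval gS gI (ysum r F) = \sum_(k < r) yeval gS gI (F k).
Proof.
rewrite -(big_mkord xpredT (fun k => yeval gS gI (F k))) /index_iota subn0 /ysum.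
by elim: (iota 0 r) => [|k s IH] /=; rewrite ?big_nil ?scale0r // big_cons IH.
Qed.

Definition yxy n (kap : ps (ps CC)) (i a j c : idx n) (p m : nat) : yterm n :=
  ysum p.+1 (fun k => ysum m.+1 (fun l =>
    YMul (YC n (kap k l)) (YMul (YS i a (m - l)) (YS j c (p - k))))).
Definition yyx n (kap : ps (ps CC)) (j c i a : idx n) (p m : nat) : yterm n :=
  ysum p.+1 (fun k => ysum m.+1 (fun l =>
    YMul (YC n (kap k l)) (YMul (YS j c (p - k)) (YS i a (m - l))))).

Section Transfer.
Variables (n : nat) (A : algType CC) (gS : idx n -> idx n -> nat -> A) (gI : 'I_n -> A).

Lemma yeval_yxy kap i a j c p m :
  (kap *: (px (gS i a) * py (gS j c)) : ps (ps A)) p m = yeval gS gI (yxy kap i a j c p m).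
Proof.
rewrite psZE ps_sumE yeval_ysum; apply: eq_bigr => k _.
rewrite psZE yeval_ysum; apply: eq_bigr => l _ /=.
by rewrite pxyE mulr_algl.
Qed.
Lemma yeval_yyx kap j c i a p m :
  (kap *: (py (gS j c) * px (gS i a)) : ps (ps A)) p m = yeval gS gI (yyx kap j c i a p m).
Proof.
rewrite psZE ps_sumE yeval_ysum; apply: eq_bigr => k _.
rewrite psZE yeval_ysum; apply: eq_bigr => l _ /=.
by rewrite pyxE mulr_algl.
Qed.

End Transfer.

(** The term is independent of the algebra: since it vanishes in every model, [is_rep] makes it
    vanish in the representation. *)
Lemma reflection_yterm n q (i j a c : idx n) p m : exists t, forall (B : algType CC)
    (hS : idx n -> idx n -> nat -> B) (hI : 'I_n -> B),
  reflection_defect q hS i j a c p m = yeval hS hI t.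
Proof.
have lin8 (K : comNzRingType) (P : lmodType K) (r1 r2 r3 r4 k1 k2 k3 k4 k5 k6 k7 k8 : K)
    (v1 v2 v3 v4 v5 v6 v7 v8 : P) :
  r1 *: (k1 *: v1 + k2 *: v2) + r2 *: (k3 *: v3 + k4 *: v4)
  - (r3 *: (k5 *: v5 + k6 *: v6) + r4 *: (k7 *: v7 + k8 *: v8))
  = (r1 * k1) *: v1 + (r1 * k2) *: v2 + (r2 * k3) *: v3 + (r2 * k4) *: v4
    + (- (r3 * k5)) *: v5 + (- (r3 * k6)) *: v6 + (- (r4 * k7)) *: v7 + (- (r4 * k8)) *: v8.
  by rewrite !opprD !scalerDr !scalerA !scaleNr !opprD !addrA.
(* The holes stand for the eight products of [lin8] and are filled by unification. *)
eexists (YAdd (YAdd (YAdd (YAdd (YAdd (YAdd (YAdd _ _) _) _) _) _) _) _) => B hS hI.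
rewrite /reflection_defect lin8 !psDE !(yeval_yxy hS hI, yeval_yyx hS hI).
by reflexivity.
Qed.

Section Rep.
Variables (n : nat) (q : CC) (d : nat).
Variables (rS : idx n -> idx n -> nat -> 'M[CC]_d.+1) (rI : 'I_n -> 'M[CC]_d.+1).
Hypotheses (q0 : q != 0) (rep : is_rep q rS rI).

Lemma rep_eq p p' :
  (forall (A : algType CC) (M : Uext_model n A), is_Uext_model q M -> yval q M p = yval q M p') ->
  yeval rS rI p = yeval rS rI p'.
Proof.
move=> pp'; apply/eqP; rewrite -subr_eq0; apply/eqP.
have := rep (p := YAdd p (YMul (YC n (-1)) p')); rewrite /= scaleN1r mulN1r; apply.
by move=> A M /pp'; rewrite /yval /= scaleN1r mulN1r => ->; rewrite subrr.
Qed.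

Lemma rep_reflection i j a c : reflection_defect q rS i j a c = 0.
Proof.
apply/psP => p; apply/psP => m; have [t tE] := reflection_yterm q i j a c p m.
rewrite (tE _ rS rI) (rep (p := t)) // => A M mM.
by rewrite /yval -tE model_reflection.
Qed.

Definition cartan0 a := rS (oidx a) (eidx a) 0%N.

Lemma cartan0_weight a k l r :
  cartan0 a * rS k l r = (weight q a k * weight q a l) *: (rS k l r * cartan0 a).
Proof.
have := rep_eq (p := YMul (YS (oidx a) (eidx a) 0) (YS k l r))
  (p' := YMul (YC n (weight q a k * weight q a l)) (YMul (YS k l r) (YS (oidx a) (eidx a) 0))).
rewrite /= mulr_algl; apply => A M mM; rewrite /yval /= mulr_algl s_coef_kcart //.
by rewrite -scalerAl kcart_s // -!scalerAr !scalerA mulrC.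
Qed.

Lemma cartan0_inv a : rI a * cartan0 a = 1 /\ cartan0 a * rI a = 1.
Proof.
split.
  have := rep_eq (p := YMul (YI a) (YS (oidx a) (eidx a) 0)) (p' := YC n 1).
  rewrite /= scale1r; apply => A M mM.
  by rewrite /yval /= scale1r; case: (sinv_kcart q0 mM a).
have := rep_eq (p := YMul (YS (oidx a) (eidx a) 0) (YI a)) (p' := YC n 1).
rewrite /= scale1r; apply => A M mM.
by rewrite /yval /= scale1r; case: (sinv_kcart q0 mM a).
Qed.

Lemma cartan0_sbar a k l r p : represents_sbar q p k l r ->
  cartan0 a * yeval rS rI p = (weight q a k * weight q a l) *: (yeval rS rI p * cartan0 a).
Proof.
move=> psb; have := rep_eq (p := YMul (YS (oidx a) (eidx a) 0) p)
  (p' := YMul (YC n (weight q a k * weight q a l)) (YMul p (YS (oidx a) (eidx a) 0))).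
rewrite /= mulr_algl; apply => A M mM; rewrite /yval /= mulr_algl s_coef_kcart //.
rewrite -/(yval q M p) psb // -scalerAl kcart_sbar // -!scalerAr !scalerA mulrC //.
Qed.

(** The definition of a highest vector mentions eigenvalues of [s_{2a,2a-1}] and [sbar_{2a,2a-1}]
    only; this identity makes it an eigenvector of [s_{2a-1,2a}^(0)] as well. *)
Lemma sbar_cartan0 a :
  represents_sbar q (YMul (YC n (- q^-1)) (YS (oidx a) (eidx a) 0)) (eidx a) (oidx a) 0.
Proof.
move=> A M mM; rewrite /yval /= mulr_algl s_coef_kcart // sbar_coef_kcart // (kcartC q0 mM).
by rewrite scalerA mulNr mulVf // scaleN1r.
Qed.
End Rep.

(** * Reordering products *)

Section ScalarReflection.
Variables (n : nat) (K : comNzRingType) (q qi x y : K).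
Implicit Types (a c i j k l M : 'I_(2 * n)).
Hypothesis dom : forall f g : K, f != 0 -> f * g = 0 -> g = 0.
Local Notation r := (rdiag q qi y x).
Local Notation o := (roff q qi y x).
Local Notation r' := (rdiag q qi (x * y) 1).
Local Notation o' := (roff q qi (x * y) 1).
Hypotheses (r0 : forall i j, r i j != 0) (r'0 : forall i j, r' i j != 0).
Hypothesis det0 : forall i j, i != j -> r' i j * r' i j - o' i j * o' j i != 0.

(* [F] and [F'] stand for a linear functional applied to the products
   [s_ia(u) s_jc(v)] and [s_jc(v) s_ia(u)]. *)
Variables F F' : 'I_(2 * n) -> 'I_(2 * n) -> 'I_(2 * n) -> 'I_(2 * n) -> K.

Definition scalar_reflection := forall i j a c,
  r i j * (r' a j * F i a j c + o' a j * F i j a c)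
  + o i j * (r' a i * F j a i c + o' a i * F j i a c)
  = r a c * (r' c i * F' j c i a + o' c i * F' j i c a)
  + o c a * (r' a i * F' j a i c + o' a i * F' j i a c).
Hypothesis refl : scalar_reflection.

(** Cramer's rule. For [i = j] the coefficient [o' i i] vanishes and the first equation suffices. *)
Lemma solve2 i j (f g : K) :
  r' i j * f + o' i j * g = 0 -> (i != j -> r' j i * g + o' j i * f = 0) -> f = 0.
Proof.
have oii k : o' k k = 0 by rewrite /roff ltnn mulr0.
have [<-|ij] := eqVneq i j; last move=> e1 /(_ isT) e2.
  by rewrite oii mul0r addr0 => /(dom (r'0 i i)).
apply: (dom (det0 ij)); rewrite (rdiag_sym _ _ _ _ j i) in e2.
have -> : (r' i j * r' i j - o' i j * o' j i) * f
  = r' i j * (r' i j * f + o' i j * g) - o' i j * (r' i j * g + o' j i * f) by ring.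
by rewrite e1 e2 !mulr0 subrr.
Qed.

Hypothesis FF' : forall k l k' l', F k l k' l' = 0 <-> F' k l k' l' = 0.

Variables (k0 l0 k1 l1 M : 'I_(2 * n)).
Local Notation arr k l k' l' := (perm_eq [:: k; l; k'; l'] [:: k0; l0; k1; l1]).

Lemma perm4_trans k l k' l' j i a c : arr k l k' l' ->
  (forall p : pred 'I_(2 * n), (p j + (p i + (p a + p c)) = p k + (p l + (p k' + p l')))%N) ->
  arr j i a c.
Proof. by move=> h e; apply: perm_trans h; apply/permP => p /=; rewrite !addn0 e. Qed.

Section Right.
Hypothesis good : forall k l k' l', arr k l k' l' -> (k' == M) || (l' == M) ->
  F k l k' l' = 0.
Let good' k l k' l' (h : arr k l k' l') h2 : F' k l k' l' = 0 := (FF' k l k' l').1 (good h h2).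

(** With [c = M] in the reflection equation, every product except [F' j M i a] has [M] in its right
    letter. *)
Lemma move_last_right j i a : arr j M i a -> F j M i a = 0.
Proof.
move=> h; have T k l k' l' := @perm4_trans _ _ _ _ k l k' l' h; have := refl i j a M.
rewrite (@good i a j M) ?(@good i j a M) ?(@good j a i M) ?(@good j i a M).
rewrite ?(@good' j i M a) ?(@good' j a i M) ?(@good' j i a M).
all: try by rewrite ?eqxx ?orbT.
all: try by apply: T => p; lia.
by rewrite !(mulr0, addr0) => /esym/(dom (r0 _ _))/(dom (r'0 _ _))/FF'.
Qed.

Lemma move_right k l k' l' : arr k l k' l' -> (k == M) || (l == M) -> F k l k' l' = 0.
Proof.
move=> h /orP[] /eqP e; last by subst; apply: move_last_right.
rewrite {k}e in h *; move: l k' l' h => a j c h.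
have T u v u' v' := @perm4_trans _ _ _ _ u v u' v' h.
have mlr k l k' (h' : arr k M l k') := (FF' _ _ _ _).1 (move_last_right h').
(* With [i = M] two unknown products survive; interchanging [j] and [a] gives a second equation, and
   [solve2] applies. *)
have half j' a' : (forall p : pred 'I_(2 * n), (p j' + p a' = p j + p a)%N) ->
    r' a' j' * F M a' j' c + o' a' j' * F M j' a' c = 0.
  move=> ja; have := refl M j' a' c.
  rewrite (@good j' a' M c) ?(@move_last_right j' a' c) ?(@good' j' c M a') ?(@mlr j' c a').
  rewrite ?(@good' j' a' M c) ?(@mlr j' a' c).
  all: try by rewrite ?eqxx ?orbT.
  all: try by apply: T => p; have := ja p; lia.
  by rewrite !(mulr0, addr0) => /(dom (r0 _ _)).
apply: (solve2 (half j a _)) => // _; apply: half => p; exact: addnC.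
Qed.
End Right.

Section Left.
Hypothesis good : forall k l k' l', arr k l k' l' -> (k == M) || (l == M) ->
  F k l k' l' = 0.
Let good' k l k' l' (h : arr k l k' l') h2 : F' k l k' l' = 0 := (FF' k l k' l').1 (good h h2).

(** With [j = M], every product except [F i a M c] has [M] in its left letter. *)
Lemma move_first_left i a c : arr i a M c -> F i a M c = 0.
Proof.
move=> h; have T k l k' l' := @perm4_trans _ _ _ _ k l k' l' h; have := refl i M a c.
rewrite (@good i M a c) ?(@good M a i c) ?(@good M i a c).
rewrite ?(@good' M c i a) ?(@good' M i c a) ?(@good' M a i c) ?(@good' M i a c).
all: try by rewrite ?eqxx ?orbT.
all: try by apply: T => p; lia.
by rewrite !(mulr0, addr0) => /(dom (r0 _ _))/(dom (r'0 _ _)).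
Qed.

Lemma move_left k l k' l' : arr k l k' l' -> (k' == M) || (l' == M) -> F k l k' l' = 0.
Proof.
move=> h /orP[] /eqP e; first by subst; apply: move_first_left.
rewrite {l'}e in h *; move: k l k' h => j c i h.
have T u v u' v' := @perm4_trans _ _ _ _ u v u' v' h.
have mfl k l k' (h' : arr k l M k') := (FF' _ _ _ _).1 (move_first_left h').
(* The instance [a = M] leaves two unknown products, interchanged by swapping [c] and [i]. *)
apply/FF'; have half c' i' : (forall p : pred 'I_(2 * n), (p c' + p i' = p c + p i)%N) ->
    r' c' i' * F' j c' i' M + o' c' i' * F' j i' c' M = 0.
  move=> ja; have := refl i' j M c'.
  rewrite (@good i' M j c') ?(@move_first_left i' j c') ?(@good j M i' c') ?(@move_first_left j i' c').
  rewrite ?(@good' j M i' c') ?(@mfl j i' c').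
  all: try by rewrite ?eqxx ?orbT.
  all: try by apply: T => p; have := ja p; lia.
  by rewrite !(mulr0, addr0) => /esym/(dom (r0 _ _)).
apply: (solve2 (half c i _)) => // _; apply: half => p; exact: addnC.
Qed.
End Left.
End ScalarReflection.

(** * Letters of height zero commute on singular vectors *)

Section RValues.
Variables (n : nat) (K : comNzRingType) (q qi U V : K) (a b : 'I_(2 * n)).
Lemma rdiag_eq : rdiag q qi U V a a = qi * U - q * V.
Proof. by rewrite /rdiag eqxx. Qed.
Lemma rdiag_lt : (a < b)%N -> rdiag q qi U V a b = U - V.
Proof. by move=> ab; rewrite /rdiag -val_eqE (ltn_eqF ab). Qed.
Lemma rdiag_gt : (b < a)%N -> rdiag q qi U V a b = U - V.
Proof. by move=> ba; rewrite /rdiag -val_eqE (gtn_eqF ba). Qed.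
Lemma roff_eq : roff q qi U V a a = 0.
Proof. by rewrite /roff ltnn mulr0. Qed.
Lemma roff_lt : (a < b)%N -> roff q qi U V a b = (qi - q) * V.
Proof. by move=> ab; rewrite /roff ltnNge (ltnW ab) ab. Qed.
Lemma roff_gt : (b < a)%N -> roff q qi U V a b = (qi - q) * U.
Proof. by move=> ba; rewrite /roff ba. Qed.
End RValues.
Arguments rdiag_lt {n K q qi U V a b}.
Arguments rdiag_gt {n K q qi U V a b}.
Arguments roff_lt {n K q qi U V a b}.
Arguments roff_gt {n K q qi U V a b}.

Section CartanCommutation.
Variables (n : nat) (K : comNzRingType) (q qi x y : K).
Implicit Types (a b c i j k l N P m p : 'I_(2 * n)).
Hypothesis dom : forall f g : K, f != 0 -> f * g = 0 -> g = 0.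
Local Notation h := (qi - q).
Local Notation D := (y - x).
Local Notation E := (x * y - 1).
Local Notation E1 := (qi * (x * y) - q * 1).
Local Notation r1 := (qi * y - q * x).
Local Notation G := (E * E - h * h * (x * y)).
Hypotheses (D0 : D != 0) (E0 : E != 0) (E10 : E1 != 0) (r10 : r1 != 0) (G0 : G != 0).

Variables F F' : 'I_(2 * n) -> 'I_(2 * n) -> 'I_(2 * n) -> 'I_(2 * n) -> K.
Hypothesis refl : scalar_reflection q qi x y F F'.
Hypothesis refl' : scalar_reflection q qi y x F' F.
Variable pos : 'I_(2 * n) -> 'I_(2 * n) -> bool.
Hypothesis dead : forall k l k' l', pos k' l' -> F k l k' l' = 0.
Hypothesis dead' : forall k l k' l', pos k' l' -> F' k l k' l' = 0.

Let domB (f u v : K) : f != 0 -> f * (u - v) = 0 -> u = v.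
Proof. by move=> f0 /(dom f0)/eqP; rewrite subr_eq0 => /eqP. Qed.

Let to0 (u v : K) : u = v -> u - v = 0.
Proof. by move=> ->; rewrite subrr. Qed.

Let sub_mul (v u c : K) : u = 0 -> v - c * u = 0 -> v = 0.
Proof. by move=> ->; rewrite mulr0 subr0. Qed.

Section SamePair.
Variables p m : 'I_(2 * n).
Hypotheses (pm : (p < m)%N) (ppos : pos p p).

(** In the instance [(m, m, p, p)] the products ending in the raising letter [s_pp] vanish, and both
    remaining ones carry the same nonzero factor. *)
Lemma cartan_mpmp : F m p m p = F' m p m p.
Proof.
have := refl m m p p; rewrite !(rdiag_eq, roff_eq) ?(rdiag_lt pm, rdiag_gt pm, roff_lt pm, roff_gt pm).
rewrite !(dead _ _ ppos) !(dead' _ _ ppos) => /to0 e1.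
apply: (domB (f := r1)) => //; apply: (dom E0).
by rewrite -[RHS]e1; ring.
Qed.

Lemma cartan_pmmp : F p m m p = F' m p p m.
Proof.
have := refl p m m p.
rewrite !(rdiag_eq, roff_eq) !(rdiag_lt pm, rdiag_gt pm, roff_lt pm, roff_gt pm).
rewrite !(dead _ _ ppos) !(dead' _ _ ppos) => /to0 e1.
apply: (domB (f := E1)) => //; apply: (dom D0).
by rewrite -[RHS]e1 cartan_mpmp; ring.
Qed.

Lemma cartan_pmpm : F p m p m = F' p m p m.
Proof.
have := refl p p m m; have := refl p m p m; have := refl' p m p m.
rewrite !(rdiag_eq, roff_eq) !(rdiag_lt pm, rdiag_gt pm, roff_lt pm, roff_gt pm) !(mulrC y x).
rewrite !(dead _ _ ppos) !(dead' _ _ ppos) => /to0 e3' /to0 e3 /to0 e1.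
have {}e1 : E * (F p m p m - F' p m p m) + h * (x * y) * (F p p m m - F' p p m m) = 0.
  by apply: (dom r10); rewrite -[RHS]e1; ring.
apply: (domB G0); apply: (dom D0).
(* The sum of [e3] and [e3'], together with [e1], is a linear system in the differences [F - F'] at
   [p m p m] and [p p m m]. Up to factors [D] its determinant is [G], and the multipliers eliminate
   the second difference. *)
apply: (sub_mul (c := D * E) e1); apply: (sub_mul (c := - h * (x * y)) e3).
by apply: (sub_mul (c := - h * (x * y)) e3'); rewrite cartan_mpmp; ring.
Qed.
End SamePair.

Section DistinctPairs.
Variables j b P N : 'I_(2 * n).
Hypotheses (jP : (j < P)%N) (jN : (j < N)%N) (bP : (b < P)%N) (bN : (b < N)%N) (PN : (P < N)%N).
Hypotheses (posj : pos j P) (posb : pos b P) (posj' : pos P j) (posb' : pos P b).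

(** All other products in the instance [(j, N, b, P)] end in a letter joining [P] to [j] or [b],
    which acts by zero. *)
Lemma cartan_NP : F j b N P = F' N P j b /\ F' j b N P = F N P j b.
Proof.
split.
  have := refl j N b P.
  rewrite ?(rdiag_lt bN, rdiag_gt bN, rdiag_lt jN, rdiag_gt jN).
  rewrite ?(rdiag_lt bP, rdiag_gt bP, rdiag_lt jP, rdiag_gt jP).
  rewrite !(dead _ _ posb, dead _ _ posj, dead _ _ posj', dead _ _ posb').
  rewrite !(dead' _ _ posb, dead' _ _ posj, dead' _ _ posj', dead' _ _ posb') => /to0 e1.
  apply: (domB D0); apply: (dom E0).
  by rewrite -[RHS]e1; ring.
have := refl' j N b P.
rewrite ?(rdiag_lt bN, rdiag_gt bN, rdiag_lt jN, rdiag_gt jN).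
rewrite ?(rdiag_lt bP, rdiag_gt bP, rdiag_lt jP, rdiag_gt jP).
rewrite !(dead _ _ posb, dead _ _ posj, dead _ _ posj', dead _ _ posb').
rewrite !(dead' _ _ posb, dead' _ _ posj, dead' _ _ posj', dead' _ _ posb') => /to0 e1.
apply: (domB D0); apply: (dom E0).
by rewrite -[RHS]oppr0 -[in RHS]e1; ring.
Qed.
End DistinctPairs.

Section DistinctPairs2.
Variables j b P N : 'I_(2 * n).
Hypotheses (jb : j != b).
Hypotheses (jP : (j < P)%N) (jN : (j < N)%N) (bP : (b < P)%N) (bN : (b < N)%N) (PN : (P < N)%N).
Hypotheses (posj : pos j P) (posb : pos b P) (posj' : pos P j) (posb' : pos P b).

Lemma cartan_PN : F P N j b = F' j b P N.
Proof.
have [c1 c1'] := cartan_NP jP jN bP bN posj posb posb'.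
have [c2 c2'] := cartan_NP bP bN jP jN posb posj posj'.
have rD U V : rdiag q qi U V b j = U - V by rewrite /rdiag eq_sym (negbTE jb).
have rD' U V : rdiag q qi U V j b = U - V by rewrite /rdiag (negbTE jb).
have := refl P j N b; have := refl P N j b; have := refl b j N P.
have := refl N j b P; have := refl' N j b P.
rewrite ?(rdiag_lt bN, rdiag_gt bN, rdiag_lt jN, rdiag_gt jN, rdiag_lt PN, rdiag_gt PN).
rewrite ?(rdiag_lt bP, rdiag_gt bP, rdiag_lt jP, rdiag_gt jP, rD, rD').
rewrite ?(roff_lt bN, roff_gt bN, roff_lt jN, roff_gt jN, roff_lt PN, roff_gt PN).
rewrite ?(roff_lt bP, roff_gt bP, roff_lt jP, roff_gt jP) ?(mulrC y x).
rewrite !(dead _ _ posb, dead _ _ posj, dead _ _ posj', dead _ _ posb').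
rewrite !(dead' _ _ posb, dead' _ _ posj, dead' _ _ posj', dead' _ _ posb').
rewrite -{}c1 -{}c1' -{}c2 {c2'}.
move: (roff q qi y x b j) => o1.
move=> /to0 e2' /to0 e2 /to0 e3 /to0 e4 /to0 e1.
have {}e2 : h * y * F j b N P - D * F' j P N b - h * y * F' j b N P = 0.
  by apply: (dom E0); rewrite -[RHS]e2; ring.
have {}e2' : h * x * F' j b N P + D * F j P N b - h * x * F j b N P = 0.
  by apply: (dom E0); rewrite -[RHS]e2'; ring.
apply: (domB G0); apply: (dom D0); apply: (dom D0).
(* [e2] and [e2'] express [F' j P N b] and [F j P N b] through [F j b N P - F' j b N P]. The
   multipliers eliminate these and the remaining products, leaving the wanted difference times
   [D ^+ 2 * G]. *)
apply: (sub_mul (c := D * E) e1); apply: (sub_mul (c := - D * h * (x * y)) e4).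
apply: (sub_mul (c := - D * h) e3); apply: (sub_mul (c := - h ^+ 2 * x * y ^+ 2 * E) e2').
apply: (sub_mul (c := - h ^+ 2 * x ^+ 2 * y * E) e2).
by ring.
Qed.
End DistinctPairs2.
End CartanCommutation.

(** * Linear functionals and scalar power series *)

Section Functional.
Variables (A : algType CC) (phi : A -> CC).
Hypotheses (phiB : forall u v, phi (u - v) = phi u - phi v)
           (phiZ : forall c u, phi (c *: u) = c * phi u).

(** Applied to the reflection equation, this gives an equation over the commutative domain
    [ps (ps CC)], where nonzero factors cancel. *)
Definition psmap (X : ps (ps A)) : ps (ps CC) := Ps (fun p => Ps (fun m => phi (X p m))).

Let phi0 : phi 0 = 0. Proof. by rewrite -(subrr 0) phiB subrr. Qed.
Let phiD u v : phi (u + v) = phi u + phi v.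
Proof. by rewrite -{1}[v]opprK phiB -[- v]sub0r phiB phi0 sub0r opprK. Qed.
Let phi_sum (n : nat) (f : nat -> A) : phi (\sum_(i < n) f i) = \sum_(i < n) phi (f i).
Proof. by elim: n => [|n IH]; rewrite ?big_ord0 // !big_ord_recr /= phiD IH. Qed.

Lemma psmap0 : psmap 0 = 0.
Proof. by apply/psP => p; apply/psP => m /=; rewrite phi0. Qed.
Lemma psmapD X Y : psmap (X + Y) = psmap X + psmap Y.
Proof. by apply/psP => p; apply/psP => m; rewrite !psDE /= !psDE phiD. Qed.
Lemma psmapB X Y : psmap (X - Y) = psmap X - psmap Y.
Proof. by apply/psP => p; apply/psP => m; rewrite !psBE /= !psBE phiB. Qed.
Lemma psmapZ k X : psmap (k *: X) = k * psmap X.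
Proof.
apply/psP => p; apply/psP => m; rewrite psME ps_sumE /= psZE ps_sumE.
rewrite (phi_sum _ (fun i => (k i *: X (p - i)%N) m)); apply: eq_bigr => i _.
rewrite psZE psME (phi_sum _ (fun j => k i j *: X (p - i)%N (m - j)%N)).
by apply: eq_bigr => j _; rewrite phiZ.
Qed.
End Functional.

(** Exchanging [x] and [y] turns the reflection equation for [Fxy] into one for [Fyx], a second set
    of equations for the same products. *)
Definition ps_swap (F : ps (ps CC)) : ps (ps CC) := Ps (fun p => Ps (fun m => F m p)).

Lemma ps_swapD : {morph ps_swap : F G / F + G}.
Proof. by move=> F G; apply/psP => p; apply/psP => m; rewrite !psDE /= !psDE. Qed.
Lemma ps_swapN : {morph ps_swap : F / - F}.
Proof. by move=> F; apply/psP => p; apply/psP => m; rewrite !psNE /= !psNE. Qed.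
Lemma ps_swapM : {morph ps_swap : F G / F * G}.
Proof.
move=> F G; apply/psP => p; apply/psP => m; rewrite psME ps_sumE /= psME ps_sumE.
rewrite [LHS](eq_bigr _ (fun i _ => psME _ _ _)) [RHS](eq_bigr _ (fun i _ => psME _ _ _)).
by rewrite exchange_big.
Qed.
Lemma ps_swap_kc c : ps_swap (kc c) = kc c.
Proof. by rewrite kc.unlock; apply/psP => -[|p]; apply/psP => -[|m]. Qed.
Lemma ps_swap1 : ps_swap 1 = 1.
Proof. by rewrite -kc1 ps_swap_kc. Qed.
Lemma ps_swap0 : ps_swap 0 = 0.
Proof. by rewrite -kc0 ps_swap_kc. Qed.
Lemma ps_swap_vx : ps_swap vx = vy.
Proof. by apply/psP => p; apply/psP => m; rewrite vyE /= vxE andbC. Qed.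
Lemma ps_swap_vy : ps_swap vy = vx.
Proof. by apply/psP => p; apply/psP => m; rewrite vxE /= vyE andbC. Qed.
Lemma ps_swap_rdiag n q U V (a b : 'I_(2 * n)) :
  ps_swap (rdiag (kc q) (kc q^-1) U V a b) = rdiag (kc q) (kc q^-1) (ps_swap U) (ps_swap V) a b.
Proof.
by rewrite /rdiag; case: ifP => _; rewrite !(ps_swapD, ps_swapN, ps_swapM, ps_swap_kc).
Qed.
Lemma ps_swap_roff n q U V (a b : 'I_(2 * n)) :
  ps_swap (roff (kc q) (kc q^-1) U V a b) = roff (kc q) (kc q^-1) (ps_swap U) (ps_swap V) a b.
Proof.
rewrite /roff !(ps_swapD, ps_swapN, ps_swapM, ps_swap_kc).
by do 2?case: ifP => _; rewrite ?ps_swap0.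
Qed.

Section Nonzero.
Variable q : CC.
Hypothesis q0 : q != 0.
Local Notation Q := (kc q).
Local Notation Qi := (kc q^-1).

Let coefs := (psBE, psNE, psDE, ps2_mul00, kc_mulE, vxE, vyE).

Lemma D_neq0 : vy - vx != 0.
Proof. by apply: (@ps2_neq0 _ 1 0); rewrite !coefs /= subr0 oner_eq0. Qed.
Lemma r1_neq0 : Qi * vy - Q * vx != 0.
Proof. by apply: (@ps2_neq0 _ 1 0); rewrite !coefs /= mulr1 mulr0 subr0 invr_neq0. Qed.
Lemma E_neq0 : vx * vy - 1 != 0.
Proof. by apply: (@ps2_neq0 _ 0 0); rewrite !coefs -kc1 kc.unlock /= mul0r sub0r oppr_eq0 oner_eq0. Qed.
Lemma E1_neq0 : Qi * (vx * vy) - Q * 1 != 0.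
Proof. by apply: (@ps2_neq0 _ 0 0); rewrite !coefs -kc1 kc.unlock /= mul0r mulr0 mulr1 sub0r oppr_eq0. Qed.
Lemma G_neq0 : (vx * vy - 1) * (vx * vy - 1) - (Qi - Q) * (Qi - Q) * (vx * vy) != 0.
Proof.
apply: (@ps2_neq0 _ 0 0); rewrite !coefs -kc1 kc.unlock /=.
by rewrite !(mul0r, mulr0) sub0r subr0 mulrNN mulr1 oner_eq0.
Qed.
End Nonzero.

Lemma ps2_domain (f g : ps (ps CC)) : f != 0 -> f * g = 0 -> g = 0.
Proof.
move=> f0 fg; apply/eqP; apply: contrapT => /negP g0.
by have := ps2_mulf_neq0 f0 g0; rewrite fg eqxx.
Qed.

Lemma scalar_reflection_map n (K : comNzRingType) (q qi x y : K) (sigma : K -> K)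
    (F F' : idx n -> idx n -> idx n -> idx n -> K) :
  {morph sigma : u v / u + v} -> {morph sigma : u v / u * v} -> sigma 1 = 1 ->
  (forall U V (a b : idx n), sigma (rdiag q qi U V a b) = rdiag q qi (sigma U) (sigma V) a b) ->
  (forall U V (a b : idx n), sigma (roff q qi U V a b) = roff q qi (sigma U) (sigma V) a b) ->
  scalar_reflection q qi x y F F' ->
  scalar_reflection q qi (sigma x) (sigma y)
    (fun i j k l => sigma (F i j k l)) (fun i j k l => sigma (F' i j k l)).
Proof.
move=> sD sM s1 sr so re i j a c; have := congr1 sigma (re i j a c).
by rewrite !(sD, sM, sr, so) s1.
Qed.

Definition height n (k l : idx n) : int := vsig k.+1 + vsig l.+1.

Lemma heightC n (k l : idx n) : height k l = height l k.
Proof. exact: addrC. Qed.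

(** [vsig] is [2a-1] at [2a-1] and [-(2a-1)] at [2a], so opposite values occur only inside such a
    pair. *)
Lemma height_eq0 n (k l : idx n) : height k l = 0 ->
  (k.+1 = l :> nat /\ ~~ odd k) \/ (l.+1 = k :> nat /\ ~~ odd l).
Proof. by rewrite /height /vsig /=; case: (boolP (odd k)); case: (boolP (odd l)) => /=; lia. Qed.

Lemma height_gt0 n (k l : idx n) : (k <= l)%N -> ~~ odd l -> 0 < height k l.
Proof. by rewrite /height /vsig /= => kl ->; case: ifP; lia. Qed.

Lemma ltn_succ_even (a b c : nat) : ~~ odd a -> ~~ odd b -> a.+1 = c -> (a < b)%N -> (c < b)%N.
Proof. lia. Qed.

(** * The reflection equation on vectors of a representation *)

Section RepFunctional.
Variables (n : nat) (q : CC) (d : nat).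
Variables (rS : idx n -> idx n -> nat -> 'M[CC]_d.+1) (rI : 'I_n -> 'M[CC]_d.+1).
Hypotheses (q0 : q != 0) (rep : is_rep q rS rI).
Implicit Types (i j k l a c M : idx n) (psi : 'rV[CC]_d.+1) (v : 'cV[CC]_d.+1).

Definition mxcoef psi v (X : 'M[CC]_d.+1) : CC := (psi *m X *m v) 0 0.

Lemma mxcoefB psi v X Y : mxcoef psi v (X - Y) = mxcoef psi v X - mxcoef psi v Y.
Proof. by rewrite /mxcoef mulmxBr mulmxBl !mxE. Qed.
Lemma mxcoefZ psi v (c : CC) X : mxcoef psi v (c *: X) = c * mxcoef psi v X.
Proof. by rewrite /mxcoef -scalemxAr -scalemxAl mxE. Qed.

Definition Fxy psi v i a j c : ps (ps CC) :=
  Ps (fun p => Ps (fun m => mxcoef psi v (rS i a m * rS j c p))).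
Definition Fyx psi v j c i a : ps (ps CC) :=
  Ps (fun p => Ps (fun m => mxcoef psi v (rS j c p * rS i a m))).

Lemma psmap_xy psi v i a j c :
  psmap (mxcoef psi v) (px (rS i a) * py (rS j c)) = Fxy psi v i a j c.
Proof. by apply/psP => p; apply/psP => m; rewrite /= pxyE. Qed.
Lemma psmap_yx psi v j c i a :
  psmap (mxcoef psi v) (py (rS j c) * px (rS i a)) = Fyx psi v j c i a.
Proof. by apply/psP => p; apply/psP => m; rewrite /= pyxE. Qed.

Lemma Fxy_refl psi v :
  scalar_reflection (kc q) (kc q^-1) vx vy (Fxy psi v) (Fyx psi v).
Proof.
move=> i j a c; have := congr1 (psmap (mxcoef psi v)) (rep_reflection q0 rep i j a c).
have fB := mxcoefB psi v; have fZ := mxcoefZ psi v.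
rewrite /reflection_defect (psmapB fB) (psmap0 fB) => /eqP; rewrite subr_eq0 => /eqP.
by rewrite !((psmapD fB), (psmapZ fB fZ), psmap_xy, psmap_yx).
Qed.

Lemma Fyx_refl psi v :
  scalar_reflection (kc q) (kc q^-1) vy vx (Fyx psi v) (Fxy psi v).
Proof.
have := scalar_reflection_map ps_swapD ps_swapM ps_swap1 (ps_swap_rdiag q) (ps_swap_roff q)
  (Fxy_refl psi v).
by rewrite ps_swap_vx ps_swap_vy.
Qed.

(** The two series have the same coefficients with [x] and [y] exchanged. *)
Lemma Fxy_Fyx psi v k l k' l' : Fxy psi v k l k' l' = 0 <-> Fyx psi v k l k' l' = 0.
Proof.
split=> /psP F0; apply/psP => p; apply/psP => m; by have := F0 m; move/psP/(_ p).
Qed.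

Lemma Fxy_eq0 psi v k l k' l' :
  Fxy psi v k l k' l' = 0 <-> forall m p, psi *m (rS k l m *m (rS k' l' p *m v)) = 0.
Proof.
split=> [/psP F0 m p|F0]; last first.
  by apply/psP => p; apply/psP => m; rewrite /= /mxcoef -!mulmxA F0 mxE.
have /psP/(_ m) := F0 p; rewrite /= /mxcoef -!mulmxA => e.
by apply/matrixP => i j; rewrite !ord1 e mxE.
Qed.

Let rdiag_neq0 i j : rdiag (kc q) (kc q^-1) vy vx i j != 0.
Proof. by rewrite /rdiag; case: ifP => _; rewrite ?D_neq0 ?r1_neq0. Qed.
Let rdiag'_neq0 i j : rdiag (kc q) (kc q^-1) (vx * vy) 1 i j != 0.
Proof. by rewrite /rdiag; case: ifP => _; rewrite ?E_neq0 ?E1_neq0. Qed.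
Let det_neq0 i j : i != j ->
  let r := rdiag (kc q) (kc q^-1) (vx * vy) 1 in let o := roff (kc q) (kc q^-1) (vx * vy) 1 in
  r i j * r i j - o i j * o j i != 0.
Proof.
move=> ij /=; rewrite /rdiag (negbTE ij); have := G_neq0 q; congr (_ != _); congr (_ - _).
have : (i != j :> nat) by []; rewrite /roff; case: ltngtP => // _ _; ring.
Qed.

Section Moves.
Variables (psi : 'rV[CC]_d.+1) (v : 'cV[CC]_d.+1) (k0 l0 k1 l1 M : idx n).
Local Notation arr k l k' l' := (perm_eq [:: k; l; k'; l'] [:: k0; l0; k1; l1]).

Lemma rep_move_right :
  (forall k l k' l', arr k l k' l' -> (k' == M) || (l' == M) ->
     forall m p, psi *m (rS k l m *m (rS k' l' p *m v)) = 0) ->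
  forall k l k' l', arr k l k' l' -> (k == M) || (l == M) ->
     forall m p, psi *m (rS k l m *m (rS k' l' p *m v)) = 0.
Proof.
move=> good k l k' l' h e; apply/Fxy_eq0.
apply: (move_right ps2_domain rdiag_neq0 rdiag'_neq0 det_neq0 (Fxy_refl psi v)) h e.
- exact: Fxy_Fyx.
- by move=> *; apply/Fxy_eq0; apply: good.
Qed.

Lemma rep_move_left :
  (forall k l k' l', arr k l k' l' -> (k == M) || (l == M) ->
     forall m p, psi *m (rS k l m *m (rS k' l' p *m v)) = 0) ->
  forall k l k' l', arr k l k' l' -> (k' == M) || (l' == M) ->
     forall m p, psi *m (rS k l m *m (rS k' l' p *m v)) = 0.
Proof.
move=> good k l k' l' h e; apply/Fxy_eq0.
apply: (move_left ps2_domain rdiag_neq0 rdiag'_neq0 det_neq0 (Fxy_refl psi v)) h e.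
- exact: Fxy_Fyx.
- by move=> *; apply/Fxy_eq0; apply: good.
Qed.
End Moves.

Let comm v k l k' l' := forall psi, Fxy psi v k l k' l' = Fyx psi v k' l' k l.

Let comm_sym v k l k' l' : comm v k l k' l' -> comm v k' l' k l.
Proof.
move=> H psi; apply/psP => p; apply/psP => m; symmetry.
exact: (congr1 (fun F : ps (ps CC) => F m p) (H psi)).
Qed.

Section Commute.
Variable v : 'cV[CC]_d.+1.
Hypothesis dead : forall k l r, 0 < height k l -> rS k l r *m v = 0.

Let pos k l := (0 < height k l)%R.
Let Fdead psi k l k' l' : pos k' l' -> Fxy psi v k l k' l' = 0.
Proof. by move=> h; apply/Fxy_eq0 => ? ?; rewrite dead // !mulmx0. Qed.
Let Fdead' psi k l k' l' : pos k' l' -> Fyx psi v k l k' l' = 0.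
Proof. by move=> h; apply/Fxy_Fyx/Fdead. Qed.

Let K : comNzRingType := ps (ps CC).
Let D0 := D_neq0. Let E0 := E_neq0. Let E10 := E1_neq0 q0.
Let r10 := r1_neq0 q0. Let G0 := G_neq0 q.

Let comm_same (p m : idx n) : p.+1 = m -> ~~ odd p ->
  [/\ comm v m p m p, comm v p m m p & comm v p m p m].
Proof.
move=> pm op; have ppm : (p < m)%N by rewrite -pm.
have ppos : pos p p by exact: height_gt0.
split=> psi.
- exact: (@cartan_mpmp n K (kc q) (kc q^-1) vx vy ps2_domain E0 r10 (Fxy psi v) (Fyx psi v)
    (Fxy_refl psi v) pos (@Fdead psi) (@Fdead' psi) p m ppm ppos).
- exact: (@cartan_pmmp n K (kc q) (kc q^-1) vx vy ps2_domain D0 E0 E10 r10 (Fxy psi v) (Fyx psi v)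
    (Fxy_refl psi v) pos (@Fdead psi) (@Fdead' psi) p m ppm ppos).
- exact: (@cartan_pmpm n K (kc q) (kc q^-1) vx vy ps2_domain D0 E0 r10 G0 (Fxy psi v) (Fyx psi v)
    (Fxy_refl psi v) (Fyx_refl psi v) pos (@Fdead psi) (@Fdead' psi) p m ppm ppos).
Qed.

Let comm_distinct (j b P N : idx n) : j != b -> (j < P)%N -> (b < P)%N -> P.+1 = N -> ~~ odd P ->
  comm v j b N P /\ comm v P N j b.
Proof.
move=> jb jP bP PN oP.
have jN : (j < N)%N by rewrite -PN ltnS ltnW.
have bN : (b < N)%N by rewrite -PN ltnS ltnW.
have PN' : (P < N)%N by rewrite -PN.
have hj (i : idx n) : (i < P)%N -> pos i P.
  by move=> /ltnW iP; apply: height_gt0.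
have hj' (i : idx n) : (i < P)%N -> pos P i.
  by move=> /ltnW iP; rewrite /pos heightC; apply: height_gt0.
split=> psi.
  exact: (@cartan_NP n K (kc q) (kc q^-1) vx vy ps2_domain D0 E0 (Fxy psi v) (Fyx psi v)
    (Fxy_refl psi v) (Fyx_refl psi v) pos (@Fdead psi) (@Fdead' psi) j b P N
    jP jN bP bN (hj _ jP) (hj _ bP) (hj' _ bP)).1.
exact: (@cartan_PN n K (kc q) (kc q^-1) vx vy ps2_domain D0 E0 G0 (Fxy psi v) (Fyx psi v)
    (Fxy_refl psi v) (Fyx_refl psi v) pos (@Fdead psi) (@Fdead' psi) j b P N
    jb jP jN bP bN PN' (hj _ jP) (hj _ bP) (hj' _ jP) (hj' _ bP)).
Qed.

(** Each letter of height zero carries the two members of a pair, in one of two orders. Equal pairs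
    are settled by [comm_same]; for distinct pairs, [main] treats the case where the second pair
    lies above the first. *)
Lemma cartan_commute k l k' l' : height k l = 0 -> height k' l' = 0 -> forall m p,
  rS k l m *m (rS k' l' p *m v) = rS k' l' p *m (rS k l m *m v).
Proof.
move=> hkl hkl' m p.
suff H : comm v k l k' l'.
  apply/row_matrixP => i; rewrite !rowE; apply/matrixP => i0 j; rewrite !ord1.
  by have /psP/(_ p)/psP/(_ m) := H (delta_mx 0 i); rewrite /= /mxcoef -!mulmxA.
have main x y : height x y = 0 -> forall P N : idx n, P.+1 = N -> ~~ odd P ->
    (x < P)%N -> (y < P)%N -> comm v x y N P /\ comm v x y P N.
  move=> hxy P N PN oP xP yP; have xy : x != y.
    by rewrite -val_eqE /= neq_ltn; case: (height_eq0 hxy) => -[<- _]; rewrite ltnSn ?orbT.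
  have [c1 c2] := comm_distinct xy xP yP PN oP; split; [exact: c1 | exact: comm_sym].
have [[kl ok]|[kl ok]] := height_eq0 hkl; have [[kl' ok']|[kl' ok']] := height_eq0 hkl'.
- have up := ltn_succ_even ok ok' kl; have dn := ltn_succ_even ok' ok kl'.
  case: (ltngtP k k') => kk'.
  + by have [] := main _ _ hkl k' l' kl' ok' kk' (up kk').
  + by apply: comm_sym; have [] := main _ _ hkl' k l kl ok kk' (dn kk').
  + have -> : k' = k by apply: val_inj.
    have -> : l' = l by apply: val_inj; rewrite /= -kl' -kl kk'.
    by have [] := comm_same kl ok.
- have up := ltn_succ_even ok ok' kl; have dn := ltn_succ_even ok' ok kl'.
  case: (ltngtP k l') => kk'.
  + by have [] := main _ _ hkl l' k' kl' ok' kk' (up kk').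
  + by apply: comm_sym; have [] := main _ _ hkl' k l kl ok (dn kk') kk'.
  + have -> : l' = k by apply: val_inj.
    have -> : k' = l by apply: val_inj; rewrite /= -kl' -kl kk'.
    by have [] := comm_same kl ok.
- have up := ltn_succ_even ok ok' kl; have dn := ltn_succ_even ok' ok kl'.
  case: (ltngtP l k') => kk'.
  + by have [] := main _ _ hkl k' l' kl' ok' (up kk') kk'.
  + by apply: comm_sym; have [] := main _ _ hkl' l k kl ok kk' (dn kk').
  + have -> : k' = l by apply: val_inj.
    have -> : l' = k by apply: val_inj; rewrite /= -kl' -kl kk'.
    by apply: comm_sym; have [] := comm_same kl ok.
- have up := ltn_succ_even ok ok' kl; have dn := ltn_succ_even ok' ok kl'.
  case: (ltngtP l l') => kk'.
  + by have [] := main _ _ hkl l' k' kl' ok' (up kk') kk'.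
  + by apply: comm_sym; have [] := main _ _ hkl' l k kl ok (dn kk') kk'.
  + have -> : l' = l by apply: val_inj.
    have -> : k' = k by apply: val_inj; rewrite /= -kl' -kl kk'.
    by have [] := comm_same kl ok.
Qed.
End Commute.
End RepFunctional.

(** * Words in non-raising letters *)

Section FourIndices.
Variable n : nat.
Implicit Types a b c e k l : idx n.

Lemma height_perm k l k' l' a b c e : perm_eq [:: k; l; k'; l'] [:: a; b; c; e] ->
  height k l + height k' l' = height a b + height c e.
Proof.
move=> h; have : \sum_(i <- [:: k; l; k'; l']) vsig i.+1
    = \sum_(i <- [:: a; b; c; e]) vsig i.+1 by exact: perm_big.
by rewrite !big_cons !big_nil /height !addr0 !addrA.
Qed.

Lemma perm4_swap a b c e : perm_eq [:: c; e; a; b] [:: a; b; c; e].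
Proof. by apply/permP => p /=; lia. Qed.
Lemma perm4_front a b c e : perm_eq [:: a; b; c; e] [:: c; a; b; e].
Proof. by apply/permP => p /=; lia. Qed.

Lemma partner k l k' l' a b c e : perm_eq [:: k; l; k'; l'] [:: a; b; c; e] ->
  (k' == a) || (l' == a) ->
  exists2 z, z \in [:: b; c; e] & height k' l' = height a z.
Proof.
move=> h /orP[] /eqP ea; subst.
  exists l'; last by [].
  have : perm_eq (a :: [:: k; l; l']) (a :: [:: b; c; e]).
    by apply: perm_trans h; apply/permP => p /=; lia.
  by rewrite perm_cons => /perm_mem <-; rewrite !inE eqxx !orbT.
exists k'; last exact: heightC.
have : perm_eq (a :: [:: k; l; k']) (a :: [:: b; c; e]).
  by apply: perm_trans h; apply/permP => p /=; lia.
by rewrite perm_cons => /perm_mem <-; rewrite !inE eqxx !orbT.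
Qed.

(** Let [hi] be the index of larger [vsig] in the raising letter and [lo] that of smaller [vsig] in
    the other one. If [height hi lo] is positive, so is the height of [hi] with any of the other
    three indices; otherwise [lo] has height at most zero with each of them. *)
Lemma extremal_index k0 l0 k1 l1 : 0 < height k0 l0 -> height k1 l1 <= 0 ->
  (exists2 M, (k0 == M) || (l0 == M) & forall k l k' l',
     perm_eq [:: k; l; k'; l'] [:: k0; l0; k1; l1] -> (k' == M) || (l' == M) -> 0 < height k' l')
  \/ (exists2 M, (k1 == M) || (l1 == M) & forall k l k' l',
     perm_eq [:: k; l; k'; l'] [:: k0; l0; k1; l1] -> (k == M) || (l == M) -> height k l <= 0).
Proof.
move=> h0 h1.
have [hi [lh [hi0 hilh hi_max hip]]] : exists hi lh, [/\ (k0 == hi) || (l0 == hi),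
    height hi lh = height k0 l0, vsig lh.+1 <= vsig hi.+1 &
    forall s, perm_eq [:: k0, l0 & s] [:: hi, lh & s]].
  case: (lerP (vsig k0.+1) (vsig l0.+1)) => h.
    exists l0, k0; rewrite eqxx orbT heightC h; split=> // s; by apply/permP => p /=; lia.
  exists k0, l0; rewrite eqxx (ltW h); split => // s; exact: perm_refl.
have [lo [hl [lo1 lohl lo_min lop]]] : exists lo hl, [/\ (k1 == lo) || (l1 == lo),
    height lo hl = height k1 l1, vsig lo.+1 <= vsig hl.+1 &
    forall s, perm_eq [:: k1, l1 & s] [:: lo, hl & s]].
  case: (lerP (vsig k1.+1) (vsig l1.+1)) => h.
    exists k1, l1; rewrite eqxx h; split => // s; exact: perm_refl.
  exists l1, k1; rewrite eqxx orbT heightC (ltW h); split=> // s; by apply/permP => p /=; lia.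
have tot : perm_eq [:: k0; l0; k1; l1] [:: hi; lh; lo; hl].
  apply: perm_trans (hip _) _; rewrite !perm_cons; exact: lop.
have [hilo|hilo] := ltrP 0 (height hi lo); [left; exists hi|right; exists lo] => //.
  move=> k l k' l' /perm_trans/(_ tot)/partner h /h[z + ->].
  rewrite !inE => /or3P[] /eqP->; rewrite ?hilh //.
  by apply: lt_le_trans hilo _; rewrite lerD2l.
move=> k l k' l' h e.
have /partner/(_ e)[z + ->] : perm_eq [:: k'; l'; k; l] [:: lo; hi; lh; hl].
  apply: perm_trans (perm4_swap _ _ _ _) _; apply: perm_trans h _.
  exact: perm_trans tot (perm4_front _ _ _ _).
rewrite !inE => /or3P[] /eqP->; rewrite ?lohl //; first by rewrite heightC.
by apply: le_trans hilo; rewrite heightC lerD2r.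
Qed.
End FourIndices.

Section Words.
Variables (n : nat) (q : CC) (d : nat).
Variables (rS : idx n -> idx n -> nat -> 'M[CC]_d.+1) (rI : 'I_n -> 'M[CC]_d.+1).
Hypotheses (q0 : q != 0) (rep : is_rep q rS rI).
Variable xi : 'cV[CC]_d.+1.
Hypothesis raise : forall k l r, 0 < height k l -> rS k l r *m xi = 0.
Implicit Types (psi : 'rV[CC]_d.+1) (L : idx n * idx n * nat) (w : seq (idx n * idx n * nat)).

Definition lmat L : 'M[CC]_d.+1 := rS L.1.1 L.1.2 L.2.
Definition lheight L : int := height L.1.1 L.1.2.
Definition act w : 'cV[CC]_d.+1 := foldr (fun L v => lmat L *m v) xi w.
Definition nonpos w := all (fun L => lheight L <= 0) w.
Definition wheight w : int := \sum_(L <- w) lheight L.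
(** Spanning is expressed dually: a vector lies in the span of some words when every row vector
    killing those words kills it. *)
Definition kills m psi := forall w, nonpos w -> size w = m -> psi *m act w = 0.

(* Double induction, on the length of the word and on the height of the raising
   letter: [extremal_index] trades that letter and its right neighbour for pairs
   whose right member is raising, the left one then having smaller height, or
   for pairs of non-raising letters. *)
Lemma raise_kills m N L psi w : 0 < lheight L -> lheight L <= N%:Z -> kills m.+1 psi ->
  nonpos w -> size w = m -> psi *m (lmat L *m act w) = 0.
Proof.
elim: m N L psi w => [|m IHm] N L psi w.
  by move=> L0 _ _ _ /size0nil ->; rewrite /= raise ?mulmx0.
elim: N L psi w => [|N IHN] L psi w L0 LN kpsi; first by case: ltP (lt_le_trans L0 LN).
case: w => // -[[k1 l1] p] w /= /andP[h1 nw] [sw].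
case: L L0 LN => [[k0 l0] m0] L0 LN; rewrite /lmat /lheight /= in L0 LN h1 *.
have step k l k' l' r r' : 0 < height k' l' -> height k l + height k' l' = height k0 l0 + height k1 l1 ->
    psi *m (rS k l r *m (rS k' l' r' *m act w)) = 0.
  move=> h' hs; rewrite mulmxA; apply: (IHm `|height k' l'|%N (k', l', r')) => //=.
    by rewrite /lheight /=; lia.
  move=> w' nw' sw'; rewrite -mulmxA.
  have [h|h] := lerP (height k l) 0; first by apply: (kpsi ((k, l, r) :: w')) => /=; rewrite ?nw' ?sw' ?andbT.
  apply: (IHN (k, l, r)) => //; rewrite /lheight /=; lia.
have [[M M0 HM]|[M M1 HM]] := extremal_index L0 h1.
  apply: (rep_move_right q0 rep (M := M) _ (perm_refl _)) => // k l k' l' prm e m1 p1.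
  by apply: step; [apply: HM prm e|exact: height_perm].
apply: (rep_move_left q0 rep (M := M) _ (perm_refl _)) => // k l k' l' prm e m1 p1.
have [h'|h'] := lerP (height k' l') 0; last by apply: step h' _; exact: height_perm.
apply: (kpsi ((k, l, m1) :: (k', l', p1) :: w)) => /=; last by rewrite sw.
by rewrite nw /lheight /= h' (HM _ _ _ _ prm e).
Qed.

(** Induction on the length: [psi *m lmat L] kills the shorter non-raising words, by [raise_kills]
    when [L] is raising and by hypothesis otherwise. *)
Lemma kills_all psi m w : kills m psi -> size w = m -> psi *m act w = 0.
Proof.
elim: m psi w => [|m IHm] psi w kpsi; first by move=> sw; apply: kpsi => //; rewrite (size0nil sw).
case: w => // L w [sw] /=; rewrite mulmxA; apply: IHm sw => w' nw' sw'.
rewrite -mulmxA; have [h|h] := lerP (lheight L) 0.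
  by apply: (kpsi (L :: w')) => /=; rewrite ?nw' ?sw' ?andbT.
by apply: (@raise_kills m `|lheight L|%N) => //; lia.
Qed.
End Words.

(** * Highest vectors *)

Lemma eigenvalue_exists m (f : 'M[CC]_m) : (0 < m)%N -> exists a : CC, eigenvalue f a.
Proof. by move=> m0; have [a] := @Theorem7' _ m f m0; exists a. Qed.

(** In a basis [R] of the row space of [U], the map [B] restricts to a square matrix; its
    eigenvectors are carried back by [R]. *)
Lemma eigenvector_in N (U B : 'M[CC]_N) : U != 0 -> (U *m B <= U)%MS ->
  exists a, exists v : 'rV_N, [/\ v != 0, (v <= U)%MS & v *m B = a *: v].
Proof.
move=> U0 UB; set R := row_base U.
have RB : (R *m B <= R)%MS.
  rewrite eq_row_base; apply: submx_trans UB; apply: submxMr; by rewrite eq_row_base.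
have [|a /eigenvalueP[u uX u0]] := @eigenvalue_exists _ (R *m B *m pinvmx R).
  by rewrite lt0n mxrank_eq0.
exists a, (u *m R); split.
- by rewrite mulmx_free_eq0 ?row_base_free.
- by apply: submx_trans (submxMl _ _) _; rewrite eq_row_base.
- by rewrite -mulmxA -[R *m B](mulmxKpV RB) mulmxA uX scalemxAl.
Qed.

(** Induction on the rank of [U]: if some [B i] is not scalar on [U], one of its eigenspaces meets
    [U] in a smaller nonzero subspace, stable because the family commutes on [U]. *)
Lemma common_eigenvector_in N (I : Type) (B : I -> 'M[CC]_N) (U : 'M[CC]_N) :
  U != 0 -> (forall i, (U *m B i <= U)%MS) ->
  (forall i j, U *m B i *m B j = U *m B j *m B i) ->
  exists u : 'rV_N, [/\ u != 0, (u <= U)%MS & forall i, exists c, u *m B i = c *: u].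
Proof.
have [r] := ubnP (\rank U); elim: r U => // r IH U rU U0 st cm.
have [scal|] := pselect (forall i, exists c, U *m B i = c *: U).
  have [i Ui] : exists i, row i U != 0.
    apply: contrapT => nU; case/eqP: U0; apply/row_matrixP => i; rewrite row0.
    by apply/eqP; apply: contrapT => /negP ?; apply: nU; exists i.
  exists (row i U); split=> // [|j]; first exact: row_sub.
  by have [c Uc] := scal j; exists c; rewrite -row_mul Uc linearZ.
move=> /existsNP[i nsc]; have [a [v [v0 vU vB]]] := eigenvector_in U0 (st i).
pose W := (U :&: eigenspace (B i) a)%MS.
have WU : (W <= U)%MS by exact: capmxSl.
have WB : W *m B i = a *: W by apply/eigenspaceP; exact: capmxSr.
have WD : exists D, W = D *m U by apply/submxP.
have Wcm j k : W *m B j *m B k = W *m B k *m B j.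
  by case: WD => D ->; rewrite -!mulmxA !(mulmxA U) cm.
have [||||u [u0 uW uB]] := IH W.
- rewrite -ltnS; apply: leq_ltn_trans rU; apply: rank_ltmx; rewrite ltmxE WU /=.
  apply: contra_notN nsc => UW; exists a.
  by have /submxP[D ->] := UW; rewrite -mulmxA WB scalemxAr.
- apply: contraNneq v0 => W0; rewrite -submx0 -W0 sub_capmx vU /=; exact/eigenspaceP.
- move=> j; rewrite sub_capmx (submx_trans (submxMr _ WU) (st j)) /=.
  by apply/eigenspaceP; rewrite Wcm WB scalemxAl.
- exact: Wcm.
by exists u; split=> //; apply: submx_trans uW WU.
Qed.

(** A matrix of maximal rank among those with row space inside [S] works, since a vector of [S]
    outside its row space would increase the rank. *)
Lemma subspace_mx N (S : 'rV[CC]_N -> Prop) :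
  S 0 -> (forall u v, S u -> S v -> S (u + v)) -> (forall c u, S u -> S (c *: u)) ->
  exists U : 'M[CC]_N, forall v, S v <-> (v <= U)%MS.
Proof.
move=> S0 SD SZ.
pose P k := `[< exists2 U : 'M[CC]_N, (forall v : 'rV_N, (v <= U)%MS -> S v) & \rank U = k >].
have exP : exists k, P k.
  exists 0%N; apply/asboolP; exists 0; rewrite ?mxrank0 // => v.
  by rewrite submx0 => /eqP ->.
have ubP k : P k -> (k <= N)%N by move=> /asboolP[U _ <-]; apply: rank_leq_row.
have [k /asboolP[U US rU] maxk] := ex_maxnP exP ubP.
exists U => v; split=> [Sv|]; last exact: US.
apply: contraT => vU.
have : P (\rank (U + v)%MS).
  apply/asboolP; exists (U + v)%MS => // u /sub_addsmxP[[u1 u2] ->]; apply: SD.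
    by apply: US; rewrite submxMl.
  by rewrite (mx11_scalar u2) mul_scalar_mx; apply: SZ.
move/maxk; rewrite leqNgt -rU; case/negP; apply: rank_ltmx.
rewrite ltmxE addsmxSl /=; apply: contra vU; apply: submx_trans; exact: addsmxSr.
Qed.

Lemma half_idx n (k : idx n) : (k./2 < n)%N.
Proof. have := ltn_ord k; lia. Qed.

(** Only the pair containing [k] contributes. The exponent [a.*2.+1] is the value of [vsig] at the
    odd member of pair [a]. *)
Lemma weight_prod n (q : CC) (k : idx n) : \prod_(a < n) weight q a k ^+ a.*2.+1 = q ^ vsig k.+1.
Proof.
rewrite (bigD1 (Ordinal (half_idx k))) //= big1 ?mulr1 => [|a ak].
  rewrite /weight /qdelta -!val_eqE /= /vsig /=.
  have -> : (k == (k./2).*2 :> nat) = ~~ odd k by lia.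
  have -> : (k == (k./2).*2.+1 :> nat) = odd k by lia.
  case: (boolP (odd k)) => ok /=.
    have -> : (1 - k.+1%:Z = - k%:Z)%R by lia.
    have -> : (k./2).*2.+1 = k by lia.
    by rewrite div1r exprVn -exprnN.
  have -> : (k./2).*2.+1 = k.+1 by lia.
  by rewrite divr1 exprnP.
rewrite /weight /qdelta -!val_eqE /= in ak *.
have -> : (k == a.*2 :> nat) = false by lia.
have -> : (k == a.*2.+1 :> nat) = false by lia.
by rewrite divr1 expr1n.
Qed.

(** * The grading operator *)

Section Grading.
Variables (n : nat) (q : CC) (d : nat).
Variables (rS : idx n -> idx n -> nat -> 'M[CC]_d.+1) (rI : 'I_n -> 'M[CC]_d.+1).
Hypotheses (q0 : q != 0) (rep : is_rep q rS rI).
Local Notation K := (cartan0 rS).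

Definition grading : 'M[CC]_d.+1 := \prod_(a < n) K a ^+ a.*2.+1.

Lemma grading_comm X (c : 'I_n -> CC) : (forall a, K a * X = c a *: (X * K a)) ->
  grading * X = (\prod_(a < n) c a ^+ a.*2.+1) *: (X * grading).
Proof.
move=> KX; have KXn a m : K a ^+ m * X = c a ^+ m *: (X * K a ^+ m).
  elim: m => [|m IH]; first by rewrite !expr0 mul1r mulr1 scale1r.
  by rewrite !exprS -mulrA IH -scalerAr (mulrA _ X) KX -scalerAl scalerA mulrA mulrC.
rewrite /grading; elim/big_rec2: _ => [|a H e _ IH]; first by rewrite mul1r mulr1 scale1r.
by rewrite -mulrA IH -scalerAr (mulrA _ X) KXn -scalerAl scalerA mulrA mulrC.
Qed.

Lemma grading_s k l r : grading * rS k l r = q ^ height k l *: (rS k l r * grading).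
Proof.
rewrite (grading_comm (c := fun a => weight q a k * weight q a l)) => [|a]; last exact: cartan0_weight rep _ _ _ _.
congr (_ *: _); under eq_bigr do rewrite exprMn.
by rewrite big_split /= !weight_prod /height expfzDr.
Qed.

Lemma cartan0_unit a : K a \is a GRing.unit.
Proof. by apply/unitrP; exists (rI a); exact: cartan0_inv q0 rep a. Qed.

Lemma grading_unit : grading \is a GRing.unit.
Proof. by apply: rpred_prod => a _; rewrite unitrX ?cartan0_unit. Qed.

Lemma grading_eig_neq0 k (v : 'cV[CC]_d.+1) : v != 0 -> grading *m v = k *: v -> k != 0.
Proof.
move=> v0 Hv; apply: contraNneq v0 => k0; rewrite k0 scale0r in Hv.
by rewrite -[v]mul1mx -[1%:M](mulVr grading_unit) -mulmxA Hv mulmx0.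
Qed.

Lemma grading_raise k (v : 'cV[CC]_d.+1) a b r : grading *m v = k *: v ->
  grading *m (rS a b r *m v) = (k * q ^ height a b) *: (rS a b r *m v).
Proof.
move=> Hv; rewrite mulmxA -[grading *m rS a b r]/(grading * _) grading_s -scalemxAl.
by rewrite -mulmxA Hv -scalemxAr scalerA mulrC.
Qed.

End Grading.

Section HighestVector.
Variables (n : nat) (q : CC) (d : nat).
Variables (rS : idx n -> idx n -> nat -> 'M[CC]_d.+1) (rI : 'I_n -> 'M[CC]_d.+1).
Hypotheses (q0 : q != 0) (qnru : forall m : nat, (0 < m)%N -> q ^+ m != 1).
Hypotheses (rep : is_rep q rS rI).
Local Notation K := (cartan0 rS).
Local Notation H := (grading rS).
Implicit Types (v xi : 'cV[CC]_d.+1) (psi : 'rV[CC]_d.+1).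

Lemma expq_inj : injective (fun h : int => q ^ h).
Proof.
have q1 (z : int) : q ^ z = 1 -> z = 0.
  case: z => [[|m]|m] //.
    by move=> e; have := @qnru m.+1 isT; rewrite [q ^+ _]e eqxx.
  rewrite NegzE -exprnN => /(congr1 GRing.inv); rewrite invrK invr1 => e.
  by have := @qnru m.+1 isT; rewrite e eqxx.
move=> h h' e; apply/eqP; rewrite -subr_eq0; apply/eqP/q1.
by rewrite expfzDr // e -expfzDr // subrr expr0z.
Qed.

(** As [q] is not a root of unity, each element of [rs] equals [k * q ^+ h] for at most one [h]. *)
Lemma eigenvalue_bound (k : CC) (rs : seq CC) : k != 0 ->
  exists B, forall h : nat, k * q ^+ h \in rs -> (h <= B)%N.
Proof.
move=> k0; elim: rs => [|z rs [B IH]]; first by exists 0%N.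
have [[h hz]|nh] := pselect (exists h, k * q ^+ h = z); last first.
  exists B => h; rewrite inE => /orP[/eqP e|]; [by case: nh; exists h|exact: IH].
exists (maxn h B) => h'; rewrite inE => /orP[/eqP|/IH hB]; last by rewrite leq_max hB orbT.
rewrite -hz => /(mulfI k0) e; suff [->] : h'%:Z = h%:Z by rewrite leq_maxl.
by apply: expq_inj; exact: e.
Qed.

Let eig (k : CC) := exists2 v : 'cV[CC]_d.+1, v != 0 & H *m v = k *: v.

Let eigE k : eig k <-> root (char_poly H^T) k.
Proof.
rewrite -eigenvalue_root_char; split=> [[v v0 Hv]|/eigenvalueP[u Hu u0]].
  by apply/eigenvalueP; exists v^T; rewrite -?trmx_mul ?Hv ?linearZ ?trmx_eq0.
by exists u^T; rewrite ?trmx_eq0 // -[H]trmxK -trmx_mul Hu linearZ.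
Qed.

Lemma top_eigenvalue : exists k, eig k /\ forall h : nat, (0 < h)%N -> ~ eig (k * q ^+ h).
Proof.
have [k0 /eigE ek0] : exists k, root (char_poly H^T) k.
  by have [k] := @eigenvalue_exists _ H^T isT; rewrite eigenvalue_root_char; exists k.
have k00 : k0 != 0 by case: ek0 => v v0 Hv; exact: (grading_eig_neq0 q0 rep v0 Hv).
have [rs rsE] : exists rs : seq CC, forall k, eig k -> k \in rs.
  have [rs rsE] := closed_field_poly_normal (char_poly H^T : {poly CC}).
  exists rs => k /eigE; rewrite rsE (monicP (char_poly_monic _)) scale1r root_prod_XsubC //.
have [B hB] := eigenvalue_bound rs k00.
(* The top eigenvalue is [k0 * q ^+ h] for the largest [h] that gives an eigenvalue. *)
pose P h := `[< eig (k0 * q ^+ h) >].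
have exP : exists h, P h by exists 0%N; apply/asboolP; rewrite mulr1.
have ubP h : P h -> (h <= B)%N by move=> /asboolP/rsE/hB.
have [h /asboolP eh maxh] := ex_maxnP exP ubP.
exists (k0 * q ^+ h); split=> // m m0; rewrite -mulrA -exprD => em.
have /maxh : P (h + m)%N by exact/asboolP.
by rewrite -{2}[h]addn0 leq_add2l leqNgt m0.
Qed.

Lemma grading_eig xi : (forall a, exists c, K a *m xi = c *: xi) ->
  exists k, H *m xi = k *: xi.
Proof.
have mulP (X Y : 'M[CC]_d.+1) : (exists c, X *m xi = c *: xi) -> (exists c, Y *m xi = c *: xi) ->
    exists c, (X * Y) *m xi = c *: xi.
  move=> [c Xc] [e Ye]; exists (c * e); rewrite -[X * Y]/(X *m Y) -mulmxA Ye -scalemxAr Xc.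
  by rewrite scalerA mulrC.
have oneP : exists c : CC, (1 : 'M[CC]_d.+1) *m xi = c *: xi by exists 1; rewrite mul1mx scale1r.
move=> Kc; rewrite /grading; elim/big_ind: _ => // a _.
by elim: (a.*2.+1) => [|m IH]; rewrite ?expr0 // exprS; apply: mulP.
Qed.

Section Cyclic.
Variable xi : 'cV[CC]_d.+1.
Hypothesis xi0 : xi != 0.
Hypothesis gen : forall v, exists p, v = yeval rS rI p *m xi.
Hypothesis raise : forall k l r, 0 < height k l -> rS k l r *m xi = 0.
Hypothesis Keig : forall a, exists c, K a *m xi = c *: xi.
Local Notation act := (act rS xi).

(** Since these eigenvalues are nonzero, the inverse generators [rI a] act on words by scalars, so
    words in the [rS] suffice. *)
Lemma act_eig a w : exists2 c, c != 0 & K a *m act w = c *: act w.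
Proof.
elim: w => [|[[k l] r] w [c c0 IH]] /=.
  have [c Kc] := Keig a; exists c => //; apply: contraNneq xi0 => c0.
  have [ri _] := cartan0_inv q0 rep a.
  by rewrite -[xi]mul1mx -[1%:M]ri -mulmxA Kc c0 scale0r mulmx0.
exists (weight q a k * weight q a l * c); first by do 2?[apply: mulf_neq0 => //]; apply: weight_neq0.
rewrite mulmxA -[K a *m _]/(K a * rS k l r) (cartan0_weight q0 rep) -scalemxAl -mulmxA IH.
by rewrite -scalemxAr scalerA.
Qed.

Lemma grading_act k w : H *m xi = k *: xi -> H *m act w = (k * q ^ wheight w) *: act w.
Proof.
move=> Hxi; elim: w => [|[[a b] r] w IH] /=; first by rewrite /wheight big_nil expr0z mulr1.
rewrite (grading_raise q0 rep _ _ _ IH) /wheight big_cons -/(wheight w) /lheight /=.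
by rewrite expfzDr // -mulrA (mulrC (q ^ wheight w)).
Qed.

(** The row vectors killing all words are stable under right multiplication by the algebra, hence
    kill everything generated by [xi]. *)
Lemma kills_gen psi : (forall w, psi *m act w = 0) -> psi = 0.
Proof.
have inv p : forall psi, (forall w, psi *m act w = 0) ->
    forall w, psi *m yeval rS rI p *m act w = 0.
  elim: p => [k l r|a|c|x IHx y IHy|x IHx y IHy] {}psi kill w /=.
  - by rewrite -mulmxA; apply: (kill ((k, l, r) :: w)).
  - have [c c0 Kc] := act_eig a w; have [ri _] := cartan0_inv q0 rep a.
    have -> : act w = c^-1 *: (K a *m act w) by rewrite Kc scalerA mulVf // scale1r.
    rewrite -scalemxAr -!mulmxA (mulmxA (rI a)) -[rI a *m K a]/(rI a * K a) ri mul1mx kill.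
    by rewrite scaler0.
  - by rewrite -scalemxAr mulmx1 -scalemxAl kill scaler0.
  - by rewrite mulmxDr mulmxDl IHx // IHy // addr0.
  - by rewrite -[_ * _]/(_ *m _) mulmxA; apply: IHy => w'; apply: IHx.
move=> kill; apply/row_matrixP => i; apply/matrixP => i0 j; rewrite !ord1.
have [p pE] := gen (delta_mx j 0).
have := inv p psi kill [::]; rewrite -mulmxA /= -pE => /matrixP/(_ 0 0).
rewrite -colE !mxE => ->; done.
Qed.

Lemma kills_nonpos psi : (forall w, nonpos w -> psi *m act w = 0) -> psi = 0.
Proof.
move=> kill; apply: kills_gen => w.
by apply: (kills_all q0 rep raise _ (erefl (size w))) => w' nw' _; apply: kill.
Qed.
End Cyclic.
End HighestVector.

(** The vectors reached from [xi] form a nonzero invariant subspace. *)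
Lemma cyclic_of_irreducible n d (rS : idx n -> idx n -> nat -> 'M[CC]_d.+1)
    (rI : 'I_n -> 'M[CC]_d.+1) (xi : 'cV[CC]_d.+1) :
  rep_irreducible rS rI -> xi != 0 -> forall v : 'cV[CC]_d.+1, exists p, v = yeval rS rI p *m xi.
Proof.
move=> irr xi0; have [|||U UE] := @subspace_mx d.+1 (fun u => exists p, u^T = yeval rS rI p *m xi).
- by exists (YC n 0); rewrite /= scale0r mul0mx trmx0.
- move=> u v [p up] [p' vp]; exists (YAdd p p').
  by rewrite linearD /= up vp mulmxDl.
- move=> c u [p up]; exists (YMul (YC n c) p).
  by rewrite linearZ /= up mulr_algl scalemxAl.
have [p|/eqmx0P U0|Ufull] := irr U.
- apply/row_subP => i; rewrite row_mul; apply/UE.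
  have /UE[p' p'E] : (row i U <= U)%MS by exact: row_sub.
  exists (YMul p p'); rewrite trmx_mul trmxK p'E /=; exact: mulmxA.
- have : (xi^T <= U)%MS by apply/UE; exists (YC n 1); rewrite trmxK /= scale1r mul1mx.
  by rewrite U0 submx0 trmx_eq0 (negbTE xi0).
- move=> v; have /UE[p pE] : (v^T <= U)%MS by exact: submx_full.
  by exists p; rewrite -pE trmxK.
Qed.

Lemma height_oe n (a : 'I_n) : height (oidx a) (eidx a) = 0.
Proof. by rewrite /height /vsig /= odd_double /=; lia. Qed.

Lemma height_eo n (k l : idx n) : ~~ odd k.+1 -> k.+1 = l.+2 -> height k l = 0.
Proof.
move=> ok [kl]; have ol : odd l.+1 by rewrite -kl; move: ok; rewrite /= negbK.
by rewrite /height /vsig (negbTE ok) ol; lia.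
Qed.

Lemma wheight_le0 n (w : seq (idx n * idx n * nat)) : nonpos w -> wheight w <= 0.
Proof.
elim: w => [|L w IH] /=; first by rewrite /wheight big_nil.
by move=> /andP[hL /IH hw]; rewrite /wheight big_cons -/(wheight w); lia.
Qed.

(** * The top eigenspace of the grading operator *)

Section TopSpace.
Variables (n : nat) (q : CC) (d : nat).
Variables (rS : idx n -> idx n -> nat -> 'M[CC]_d.+1) (rI : 'I_n -> 'M[CC]_d.+1).
Hypotheses (q0 : q != 0) (qnru : forall m : nat, (0 < m)%N -> q ^+ m != 1).
Hypotheses (rep : is_rep q rS rI).
Local Notation K := (cartan0 rS).
Local Notation H := (grading rS).

Section Top.
Variables (xi : 'cV[CC]_d.+1) (k : CC).
Hypotheses (xi0 : xi != 0) (Hxi : H *m xi = k *: xi).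
Hypothesis gen : forall v, exists p, v = yeval rS rI p *m xi.
Hypothesis raise : forall k l r, 0 < height k l -> rS k l r *m xi = 0.
Hypothesis zero : forall k l r, height k l = 0 -> exists c, rS k l r *m xi = c *: xi.

Let Keig a : exists c, K a *m xi = c *: xi.
Proof. by apply: zero; apply: height_oe. Qed.

Lemma act_zero w : nonpos w -> wheight w = 0 -> exists c, act rS xi w = c *: xi.
Proof.
elim: w => [|[[a b] r] w IH] /=; first by exists 1; rewrite scale1r.
move=> /andP[hL hw]; rewrite /wheight big_cons -/(wheight w) => h0.
have hw0 := wheight_le0 hw; rewrite /lheight /= in hL h0.
have [|c ->] := IH hw; first by lia.
have [|e He] := @zero a b r; first by lia.
by exists (c * e); rewrite /lmat /= -scalemxAr He scalerA.
Qed.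

(** Otherwise some nonzero left [k]-eigenvector of [H] kills [xi]. It kills words of total height
    zero, which are multiples of [xi], and words of negative height, which have other eigenvalues;
    so it is zero. *)
Lemma top_space_dim1 v : H *m v = k *: v -> exists c, v = c *: xi.
Proof.
move=> Hv; have [/sub_rVP[c e]|vxi] := boolP (v^T <= xi^T)%MS.
  by exists c; apply: trmx_inj; rewrite e linearZ.
pose A := H - k%:M.
have kerA (u : 'cV[CC]_d.+1) : H *m u = k *: u -> (u^T <= kermx A^T)%MS.
  by move=> Hu; apply/sub_kermxP; rewrite -trmx_mul mulmxBl Hu mul_scalar_mx subrr trmx0.
(* Left and right eigenspaces have equal dimension. *)
have rk : (1 < \rank (kermx A))%N.
  rewrite mxrank_ker -mxrank_tr -mxrank_ker.
  apply: (@leq_trans (\rank (xi^T + v^T)%MS)); last by apply: mxrankS; rewrite addsmx_sub !kerA.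
  apply: (@leq_ltn_trans (\rank xi^T)); first by rewrite rank_rV trmx_eq0 xi0.
  by apply: rank_ltmx; rewrite ltmxE addsmxSl addsmx_sub submx_refl.
set R := row_base (kermx A).
(* Killing [xi] is one linear condition on a space of dimension at least two. *)
have : kermx (R *m xi) != 0.
  rewrite -mxrank_eq0 mxrank_ker -lt0n subn_gt0; apply: leq_ltn_trans rk.
  exact: rank_leq_col.
move=> /rowV0Pn[u /sub_kermxP uR u0].
have Ru0 : u *m R != 0 by rewrite mulmx_free_eq0 ?row_base_free.
suff R0 : u *m R = 0 by rewrite R0 eqxx in Ru0.
apply: (kills_nonpos q0 rep xi0 gen raise Keig) => w nw.
have RH : u *m R *m H = k *: (u *m R).
  have : (R <= kermx A)%MS by rewrite eq_row_base.
  move/sub_kermxP; rewrite mulmxBr mul_mx_scalar => /eqP; rewrite subr_eq0 => /eqP RH.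
  by rewrite -mulmxA RH -scalemxAr.
have [w0|w0] := eqVneq (wheight w) 0.
  by have [c ->] := act_zero nw w0; rewrite -scalemxAr -mulmxA uR scaler0.
have k0 : k != 0 by exact: (grading_eig_neq0 q0 rep xi0 Hxi).
have : k *: (u *m R *m act rS xi w) = (k * q ^ wheight w) *: (u *m R *m act rS xi w).
  by rewrite scalemxAl -RH -mulmxA (grading_act q0 rep _ Hxi) scalemxAr.
move/eqP; rewrite -scalerA -subr_eq0 -scalerBr scaler_eq0 (negbTE k0) /=.
rewrite -[X in X - _]scale1r -scalerBl scaler_eq0 subr_eq0 => /orP[/eqP e|/eqP //].
by case/eqP: w0; apply: (expq_inj q0 qnru); rewrite /= -e expr0z.
Qed.
End Top.

Lemma grading_height0 k l r : height k l = 0 -> H * rS k l r = rS k l r * H.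
Proof. by move=> h0; rewrite (grading_s q0 rep) h0 expr0z scale1r. Qed.

Lemma grading_sbar k l r p : represents_sbar q p k l r -> height k l = 0 ->
  H * yeval rS rI p = yeval rS rI p * H.
Proof.
move=> psb h0; rewrite (grading_comm (c := fun a => weight q a k * weight q a l)) => [|a].
  under eq_bigr do rewrite exprMn.
  have := expfzDr (vsig k.+1) (vsig l.+1) q0; rewrite -/(height k l) h0 expr0z => e.
  by rewrite big_split /= !weight_prod // -e scale1r.
exact: (cartan0_sbar q0 rep a psb).
Qed.

Lemma top_vector : exists (xi : 'cV[CC]_d.+1) (k : CC), [/\ xi != 0, H *m xi = k *: xi,
  forall h : nat, (0 < h)%N -> forall v : 'cV[CC]_d.+1, H *m v = (k * q ^+ h) *: v -> v = 0,
  forall a b r, 0 < height a b -> rS a b r *m xi = 0 &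
  forall a b r, height a b = 0 -> exists c, rS a b r *m xi = c *: xi].
Proof.
have [k [[v0 v00 Hv0] ktop]] := top_eigenvalue q0 qnru rep.
have top h (h0 : (0 < h)%N) (v : 'cV[CC]_d.+1) : H *m v = (k * q ^+ h) *: v -> v = 0.
  by move=> Hv; apply/eqP; apply: contrapT => /negP v1; apply: (ktop h h0); exists v.
have raise (v : 'cV[CC]_d.+1) : H *m v = k *: v ->
    forall a b r, 0 < height a b -> rS a b r *m v = 0.
  move=> Hv a b r h; apply: (top `|height a b|%N); first by lia.
  by rewrite (grading_raise q0 rep _ _ _ Hv) exprnP gez0_abs // ltW.
pose U := kermx (H - k%:M)^T.
have UE (u : 'rV[CC]_d.+1) : (u <= U)%MS -> H *m u^T = k *: u^T.
  move/sub_kermxP => /(congr1 trmx); rewrite trmx_mul trmxK trmx0 mulmxBl mul_scalar_mx.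
  by move/eqP; rewrite subr_eq0 => /eqP.
(* The letters of height zero preserve the eigenspace [U]. They are only known to commute on it,
   where raising letters act by zero. *)
pose I := {L : idx n * idx n * nat | height L.1.1 L.1.2 == 0}.
pose B (i : I) : 'M[CC]_d.+1 := (rS (sval i).1.1 (sval i).1.2 (sval i).2)^T.
have [|i|i j|u [u0 uU uB]] := @common_eigenvector_in _ I B U.
- apply: contraNneq v00 => U0; rewrite -trmx_eq0 -submx0 -U0; apply/sub_kermxP.
  by rewrite -trmx_mul mulmxBl Hv0 mul_scalar_mx subrr trmx0.
- apply/sub_kermxP; rewrite -mulmxA -trmx_mul mulmxBl.
  rewrite -[H *m _]/(H * _) grading_height0; last exact/eqP/(svalP i).
  by rewrite mul_scalar_mx -mul_mx_scalar -mulmxBr trmx_mul mulmxA mulmx_ker mul0mx.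
- apply/row_matrixP => m; rewrite !(row_mul _ _ (B _)) /B.
  have /UE : (row m U <= U)%MS by exact: row_sub.
  move: (row m U) => w Hw; apply: trmx_inj; rewrite !trmx_mul !trmxK.
  exact: (cartan_commute q0 rep (raise _ Hw) (eqP (svalP j)) (eqP (svalP i)) _ _).
exists u^T, k; split=> //; rewrite ?trmx_eq0 //; [exact: UE|exact: raise (UE _ uU)|].
move=> a b r /eqP h0; have [c uc] := uB (exist _ (a, b, r) h0); exists c.
by apply: trmx_inj; rewrite trmx_mul trmxK linearZ /= trmxK.
Qed.
End TopSpace.

Theorem theorem4p2 (q : CC) (n : nat) :
  q != 0 -> (forall m : nat, (0 < m)%N -> q ^+ m != 1) -> (1 <= n)%N ->
  forall (d : nat) (rS : idx n -> idx n -> nat -> 'M[CC]_d.+1)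
         (rI : 'I_n -> 'M[CC]_d.+1),
    is_rep q rS rI -> rep_irreducible rS rI ->
    exists xi : 'cV[CC]_d.+1,
      highest_vector q rS rI xi /\
      (forall xi' : 'cV[CC]_d.+1, highest_vector q rS rI xi' ->
         exists c : CC, xi' = c *: xi).
Proof.
move=> q0 qnru _ d rS rI rep irr.
have [xi [k [xi0 Hxi top raise zero]]] := top_vector q0 qnru rep.
have gen := cyclic_of_irreducible irr xi0.
have dim1 := top_space_dim1 q0 qnru rep xi0 Hxi gen raise zero.
exists xi; split; first split=> //.
- by move=> i j r ok kl; apply: zero; exact: height_eo ok kl.
(* An element representing a coefficient of [sbar_{2a,2a-1}] commutes with [H], so it preserves the
   line of [xi]. *)
- move=> i j r ok kl p psb; apply: dim1.
  have Hp := grading_sbar q0 rep psb (height_eo ok kl).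
  by rewrite mulmxA -[_ *m yeval _ _ _]/(_ * _) Hp -mulmxA Hxi -scalemxAr.
move=> xi' [xi'0 gen' raise' _ sbar'].
have Keig' a : exists c, cartan0 rS a *m xi' = c *: xi'.
  have [||c] := sbar' (eidx a) (oidx a) 0%N _ _ _ (sbar_cartan0 q0 a); rewrite /= ?odd_double //.
  rewrite mulr_algl -scalemxAl => e; exists (- q * c).
  by rewrite -scalerA -e scalerA mulrNN mulfV // scale1r.
have [k' Hxi'] := grading_eig Keig'.
apply: dim1; suff <- : k' = k by [].
(* A nonzero left [k]-eigenvector cannot kill all non-raising words on [xi'], so one of these words
   has [H]-eigenvalue [k]. *)
have [u uH u0] : exists2 u : 'rV[CC]_d.+1, u *m grading rS = k *: u & u != 0.
  apply/eigenvalueP; rewrite /eigenvalue -mxrank_eq0 mxrank_ker subn_eq0 -ltnNge.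
  have /mulmx0_rank_max : (grading rS - k%:M) *m xi = 0.
    by rewrite mulmxBl Hxi mul_scalar_mx subrr.
  apply: leq_trans; rewrite -addn1 leq_add2l lt0n mxrank_eq0; exact: xi0.
have [w [nw kw]] : exists w : seq (idx n * idx n * nat), nonpos w /\ k = k' * q ^ wheight w.
  apply: contrapT => nex; case/eqP: u0.
  apply: (@kills_nonpos _ _ _ _ _ q0 rep _ xi'0 gen' raise' Keig') => w nw.
  have : k *: (u *m act rS xi' w) = (k' * q ^ wheight w) *: (u *m act rS xi' w).
    by rewrite scalemxAl -uH -mulmxA (grading_act q0 rep _ Hxi') scalemxAr.
  move/eqP; rewrite -subr_eq0 -scalerBl scaler_eq0 subr_eq0 => /orP[/eqP e|/eqP //].
  by case: nex; exists w.
have := wheight_le0 nw; rewrite le_eqVlt => /orP[/eqP w0|w0].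
  by rewrite kw w0 expr0z mulr1.
(* A word of negative height would give [k' = k * q ^+ h] with [h > 0], against the maximality of
   [k]. *)
case/eqP: xi'0; apply: (top `|wheight w|%N); first by lia.
rewrite Hxi' kw exprnP -mulrA -expfzDr //.
have -> : wheight w + `|wheight w|%N = 0 by lia.
by rewrite expr0z mulr1.
Qed.
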